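(* Let $d=2$. On any triangle $T\in\mathcal T$ the following statements hold. (a) The functions $\{\boldsymbol\psi^{\mathrm{RT}_1}_j\}_{j=1,2}\subset\widetilde{\boldsymbol{RT}}{}_1^{\rm int}(T)$ are linearly independent and $\int_T\mathrm{div}(\boldsymbol\psi_j^{\mathrm{RT}_1})\,d\boldsymbol x=0$. For $\boldsymbol V_h^{\rm R}(T):=\mathrm{span}\{\boldsymbol\psi_1^{\mathrm{RT}_1},\boldsymbol\psi_2^{\mathrm{RT}_1}\}=\widetilde{\boldsymbol{RT}}{}_1^{\rm int}(T)$, the restricted divergence operator $\mathrm{div}:\boldsymbol V_h^{\rm R}(T)\to\widehat Q_h^\perp(T)$ for $\widehat Q_h(T)=P_0(T)$, i.e. $\widehat Q_h^\perp(T)=\{q\in P_1(T):(q,r)_T=0\ \forall r\in P_0(T)\}$, is bijective. (b) The functions $$\boldsymbol\psi_j^{\mathrm{RT}_2}:=(5\varphi_j-2)\,\boldsymbol\psi_j^{\mathrm{RT}_1}\in\widetilde{\boldsymbol{RT}}{}_2^{\rm int}(T),\qquad j=1,2,3,$$ are linearly independent, and $\int_T\mathrm{div}(\boldsymbol\psi_j^{\mathrm{RT}_2})\varphi_k\,d\boldsymbol x=0$ for $j,k=1,2,3$. For $\boldsymbol V_h^{\rm R}(T):=\mathrm{span}\{\boldsymbol\psi_j^{\mathrm{RT}_2}:j=1,2,3\}$, the restricted divergence operator $\mathrm{div}:\boldsymbol V_h^{\rm R}(T)\to\widehat Q_h^\perp(T)$ for $\widehat Q_h(T)=P_1(T)$,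 i.e. $\widehat Q_h^\perp(T)=\{q\in P_2(T):(q,r)_T=0\ \forall r\in P_1(T)\}$, is bijective. (c) The three functions $$\boldsymbol\psi_j^{\mathrm{RT}_3}:=\tfrac17\left(7\varphi_j^2-6\varphi_j+1\right)\boldsymbol\psi_j^{\mathrm{RT}_1}\in\widetilde{\boldsymbol{RT}}{}_3^{\rm int}(T),\qquad j=1,2,3,$$ and additionally $$\boldsymbol\psi_4^{\mathrm{RT}_3}:=-2\varphi_2\varphi_3\boldsymbol\psi_2^{\mathrm{RT}_1}+\tfrac{2}{45}\left(\boldsymbol\psi_1^{\mathrm{RT}_1}+5\boldsymbol\psi_2^{\mathrm{RT}_1}\right)+\tfrac1{70}\left(3\boldsymbol\psi_1^{\mathrm{RT}_2}+2\boldsymbol\psi_2^{\mathrm{RT}_2}-3\boldsymbol\psi_3^{\mathrm{RT}_2}\right)\in\widetilde{\boldsymbol{RT}}{}_3^{\rm int}(T)$$ are linearly independent, and $\int_T\mathrm{div}(\boldsymbol\psi_j^{\mathrm{RT}_3})\lambda_h\,d\boldsymbol x=0$ for all $\lambda_h\in P_2(T)$ and $j=1,2,3,4$. For $\boldsymbol V_h^{\rm R}(T):=\mathrm{span}\{\boldsymbol\psi_j^{\mathrm{RT}_3}:j=1,2,3,4\}$, the restricted divergence operator $\mathrm{div}:\boldsymbol V_h^{\rm R}(T)\to\widehat Q_h^\perp(T)$ for $\widehat Q_h(T)=P_2(T)$, i.e. $\widehat Q_h^\perp(T)=\{q\in P_3(T):(q,r)_T=0\ \forall r\in P_2(T)\}$,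 is bijective.
   Context: $\mathcal T$ is a regular simplicial triangulation of a bounded polyhedral Lipschitz domain in $\mathbb R^d$. $P_k(T)$ denotes polynomials of degree $\le k$ on $T$, $\boldsymbol P_k(T)$ vector-valued ones, and $(\cdot,\cdot)_T$ the $L^2(T)$ inner product. A simplex $T\in\mathcal T$ has vertices $\boldsymbol P_j$, $j=1,\dots,d+1$, and $\varphi_j$ is the nodal (barycentric) basis function of $\boldsymbol P_j$, i.e. the affine function with $\varphi_j(\boldsymbol P_k)=\delta_{jk}$. Set $$\boldsymbol\psi_j^{\mathrm{RT}_0}:=\frac1{d|T|}(\boldsymbol x-\boldsymbol P_j),\qquad \boldsymbol\psi_j^{\mathrm{RT}_1}:=\varphi_j\,\boldsymbol\psi_j^{\mathrm{RT}_0},\qquad j=1,\dots,d+1.$$ $\boldsymbol{RT}_m(T)=\{\boldsymbol p+q\boldsymbol x:\boldsymbol p\in\boldsymbol P_m(T),q\in P_m(T)\}$, $\boldsymbol{RT}_m^{\rm int}(T)=\{\boldsymbol v\in\boldsymbol{RT}_m(T):\boldsymbol v\cdot\boldsymbol n_T=0\text{ on }\partial T\}$, where $\boldsymbol n_T$ is the outer unit normal. $\widetilde{\boldsymbol{RT}}{}_m^{\rm int}(T)$ denotes an arbitrary but fixed complement in $\boldsymbol{RT}_m^{\rm int}(T)$ of its subspace of divergence-free functions (not unique in general); it is required that the spaces $\widetilde{\boldsymbol{RT}}{}_m^{\rm int}(T)$, $T\in\mathcal T$, are all connected to one and the same reference space via Piola's transformation. One has $\widetilde{\boldsymbol{RT}}{}_1^{\rm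 int}(T)=\boldsymbol{RT}_1^{\rm int}(T)$. $\widehat Q_h^\perp(T)$ is the $L^2(T)$-orthogonal complement of $\widehat Q_h(T)$ in $P_{k-1}(T)$, where $k=2,3,4$ in (a), (b), (c), respectively.
   Formalization: In (b) and (c) membership in the complement cannot hold for an arbitrary complement (add the curl of the cubic bubble to one function); it is stated as existence of an admissible, Piola-compatible choice of complements on all triangles that contains the functions. *)

(* Defs.v *)
From HB Require Import structures.
From mathcomp Require Import all_boot all_order all_algebra.
From mathcomp Require Import all_classical all_reals all_analysis.

Set Implicit Arguments.
Unset Strict Implicit.
Unset Printing Implicit Defensive.

Import Order.TTheory GRing.Theory Num.Theory.
Import numFieldNormedType.Exports.

Local Open Scope classical_set_scope.
Local Open Scope ring_scope.

(* d = 2 throughout and the plane is R * R.  Since a triangle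
   has nonempty interior, a polynomial (field) on it is identified with its
   unique polynomial extension to the plane: the spaces below are sets of
   functions on R * R. *)

Section TriangleGeometry.
Variable R : realType.

(* The library norm on R * R is the sup norm, hence this explicit Euclidean
   inner product. *)
Definition dot (u v : R * R) : R := u.1 * v.1 + u.2 * v.2.

Definition cross (u v : R * R) : R := u.1 * v.2 - u.2 * v.1.

(* P_1, P_2, P_3 have indices 0, 1, 2. *)
Record triangle := Triangle {
  vertex :> 'I_3 -> R * R;
  triangle_nondeg : cross (vertex 1 - vertex 0) (vertex 2 - vertex 0) != 0 }.

Definition tri_set (T : triangle) : set (R * R) :=
  [set x | exists t : 'I_3 -> R, [/\ forall i, 0 <= t i, \sum_i t i = 1
                                  & x = \sum_i t i *: T i]].

(* The edge opposite to vertex j; the boundary of T is the union of its edges. *)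
Definition edge (T : triangle) (j : 'I_3) : set (R * R) :=
  [set x | exists t : 'I_3 -> R, [/\ forall i, 0 <= t i, \sum_i t i = 1,
                                    t j = 0 & x = \sum_i t i *: T i]].

(* On the edge opposite to vertex j. *)
Definition outer_unit_normal (T : triangle) (j : 'I_3) (n : R * R) : Prop :=
  [/\ dot n n = 1,
      forall k l, k != j -> l != j -> dot n (T k - T l) = 0
    & forall k, k != j -> dot n (T j - T k) < 0].

Definition plane_measure :
    {measure set (measurableTypeR R * measurableTypeR R) -> \bar R} :=
  (@lebesgue_measure R \x @lebesgue_measure R)%E.

Definition area (T : triangle) : R := fine (plane_measure (tri_set T)).

Definition tri_int (T : triangle) (f : R * R -> R) : R :=
  \int[plane_measure]_(x in tri_set T) f x.

End TriangleGeometry.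

Section LinearNotions.
Variable R : realType.
Implicit Types A D W : set (R * R -> R * R).

Definition is_subspace W : Prop :=
  W 0 /\ forall (a : R) u v, W u -> W v -> W (a *: u + v).

Definition is_complement A D W : Prop :=
  [/\ is_subspace W, W `<=` A, W `&` D = [set 0]
    & forall v, A v -> exists w d, [/\ W w, D d & v = w + d]].

Definition lspan n (f : 'I_n -> R * R -> R * R) : set (R * R -> R * R) :=
  [set v | exists c : 'I_n -> R, v = \sum_i c i *: f i].

Definition lin_indep (T : triangle R) n (f : 'I_n -> R * R -> R * R) : Prop :=
  forall c : 'I_n -> R,
    (forall x, tri_set T x -> \sum_i c i *: f i x = 0) -> forall i, c i = 0.

End LinearNotions.

Section PolynomialSpaces.
Variable R : realType.

Definition Pol (k : nat) : set (R * R -> R) :=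
  [set f | exists c : nat -> nat -> R, forall x, f x =
     \sum_(i < k.+1) \sum_(j < k.+1 | (i + j <= k)%N)
       c i j * x.1 ^+ i * x.2 ^+ j].

Definition divergence (v : R * R -> R * R) (x : R * R) : R :=
  'D_((1, 0) : R * R) (fun y => (v y).1) x
  + 'D_((0, 1) : R * R) (fun y => (v y).2) x.

Definition RT (m : nat) : set (R * R -> R * R) :=
  [set v | exists p1 p2 q, [/\ Pol m p1, Pol m p2, Pol m q
                             & forall x, v x = (p1 x, p2 x) + q x *: x]].

Definition RTint (m : nat) (T : triangle R) : set (R * R -> R * R) :=
  [set v | RT m v /\ forall j n x,
     outer_unit_normal T j n -> edge T j x -> dot (v x) n = 0].

Definition RTint_divfree (m : nat) (T : triangle R) : set (R * R -> R * R) :=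
  [set v | RTint m T v /\ forall x, tri_set T x -> divergence v x = 0].

(* The affine map from the reference triangle with vertices (0,0), (1,0), (0,1)
   to T that respects the numbering of the vertices, and its linear part. *)
Definition affine_lin (T : triangle R) (y : R * R) : R * R :=
  y.1 *: (T 1 - T 0) + y.2 *: (T 2 - T 0).

Definition affine_map (T : triangle R) (y : R * R) : R * R :=
  T 0 + affine_lin T y.

Definition affine_det (T : triangle R) : R := cross (T 1 - T 0) (T 2 - T 0).

(* The Piola transform v of w is v (F y) = DF (w y) / det DF, F = affine_map T;
   this determines v, because F is a bijection of the plane. *)
Definition piola_image (T : triangle R) (W : set (R * R -> R * R)) :
    set (R * R -> R * R) :=
  [set v | exists2 w, W w & forall y,
     v (affine_map T y) = (affine_det T)^-1 *: affine_lin T (w y)].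

(* W is an admissible choice of the spaces \widetilde{RT}_m^int(T), T \in Th. *)
Definition RTtilde (Th : set (triangle R)) (m : nat)
    (W : triangle R -> set (R * R -> R * R)) : Prop :=
  (forall T, Th T -> is_complement (RTint m T) (RTint_divfree m T) (W T)) /\
  exists What, forall T, Th T -> W T = piola_image T What.

(* The L^2(T)-orthogonal complement of Q in Pol k, for Q included in Pol k. *)
Definition Qperp (T : triangle R) (k : nat) (Q : set (R * R -> R)) :
    set (R * R -> R) :=
  [set q | Pol k q /\ forall r, Q r -> tri_int T (fun x => q x * r x) = 0].

Definition nodal_basis (T : triangle R) (phi : 'I_3 -> R * R -> R) : Prop :=
  forall j, Pol 1 (phi j) /\ forall k, phi j (T k) = (j == k)%:R.

End PolynomialSpaces.

Section BasisFunctions.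
Variables (R : realType) (T : triangle R) (phi : 'I_3 -> R * R -> R).

Definition psiRT0 (j : 'I_3) (x : R * R) : R * R :=
  (2 * area T)^-1 *: (x - T j).

Definition psiRT1 (j : 'I_3) (x : R * R) : R * R :=
  phi j x *: psiRT0 j x.

Definition psiRT2 (j : 'I_3) (x : R * R) : R * R :=
  (5 * phi j x - 2) *: psiRT1 j x.

Definition psiRT3 (j : 'I_3) (x : R * R) : R * R :=
  (7^-1 * (7 * phi j x ^+ 2 - 6 * phi j x + 1)) *: psiRT1 j x.

Definition psiRT3_4 (x : R * R) : R * R :=
  (- 2 * phi 1 x * phi 2 x) *: psiRT1 1 x
  + (2 / 45) *: (psiRT1 0 x + 5 *: psiRT1 1 x)
  + 70^-1 *: (3 *: psiRT2 0 x + 2 *: psiRT2 1 x - 3 *: psiRT2 2 x).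

(* Only two of the three functions psi_j^{RT_1}: the third one depends on them. *)
Definition familyRT1 (j : 'I_2) : R * R -> R * R :=
  psiRT1 (widen_ord (isT : (2 <= 3)%N) j).

Definition familyRT3 (j : 'I_4) : R * R -> R * R :=
  if unlift ord_max j is Some i then psiRT3 i else psiRT3_4.

End BasisFunctions.

(* Main.v *)
Require Import Defs.
From HB Require Import structures.
From mathcomp Require Import all_boot all_order all_algebra.
From mathcomp Require Import all_classical all_reals all_analysis.
From mathcomp Require Import measurable_realfun ring lra.

(** Every triangle T is the image of the reference simplex with vertices (0,0),
    (1,0), (0,1) under an affine chart F.  The chart preserves the polynomial
    spaces, multiplies integrals by twice the area of T and turns the nodal
    functions into barycentric coordinates.  All fields of the theorem are sums of
    radial fields f (x - P_j), where the polynomial f is divisible by phi_j.  Such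
    a field is tangential on all three edges: f vanishes on the edge opposite to
    P_j, and on the other two x - P_j points along the edge (RTint_radial).
    Except for one term of psi_4, f = g(phi_j) with a univariate polynomial g.
    Since phi_j is affine on the lines through P_j, the divergence is then
    2 g(phi_j) + g'(phi_j) (phi_j - 1) (divergence_barycentric).  In the chart,
    and up to the factor 1 / (2 |T|), the divergences of the basis functions are
    therefore fixed polynomials with rational coefficients (divRT1, divRT2,
    divRT3), the same for all triangles.

    About these polynomials three facts are computed.  Those of degree k + 1 are
    orthogonal to all polynomials of degree k, because the moments of the
    simplex are known; they are linearly independent; and their leading forms
    span the forms of degree k + 1.  The record enrichment collects the three
    facts on T.  They give the bijectivity (enrichment_bij): from q of degree
    k + 1 subtract the combination of divergences that has the same leading
    form; the remainder has degree at most k and, if q is orthogonal to all polynomials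
    of degree k, so is the remainder, which hence vanishes.

    The complements are obtained by stacking the families.  If the divergence
    maps the span of a family bijectively onto the polynomials of degree m with
    mean value zero, then adding an enrichment of degree m + 1 yields the same
    for m + 1 (div_basis_enrich).  By the divergence theorem the divergence of
    any v in RT_m^int has mean value zero (tri_int_divergence), so v differs
    from exactly one element of the span by a divergence-free field
    (div_basis_complement).  The families on T are a fixed multiple of the
    Piola transforms of the families on the reference triangle, so these
    complements are connected to one reference space (lspan_piola).  For m = 1
    the span is all of RT_1^int, by comparing coefficients in the chart
    (RTint1_lspan); hence RT_1^int contains no divergence-free field other than
    zero, and it is the only complement. *)

Set Implicit Arguments.
Unset Strict Implicit.
Unset Printing Implicit Defensive.

Import Order.TTheory GRing.Theory Num.Theory.
Import numFieldNormedType.Exports.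

Local Open Scope classical_set_scope.
Local Open Scope ring_scope.

(** * Scalars and small index sets *)
Lemma scaleRE (R : realType) (a z : R) : a *: z = a * z.
Proof. by []. Qed.

Lemma ord2P (j : 'I_2) : j = 0 \/ j = 1.
Proof. by case: j => [[|[|//]] ?]; [left|right]; apply: val_inj. Qed.

Lemma ord4P (j : 'I_4) : [\/ j = 0, j = 1, j = 2 | j = 3].
Proof.
by case: j => [[|[|[|[|//]]]] ?];
  [apply: Or41|apply: Or42|apply: Or43|apply: Or44]; apply: val_inj.
Qed.

Lemma sum2E (V : nmodType) (f : 'I_2 -> V) : \sum_i f i = f 0 + f 1.
Proof.
by rewrite !big_ord_recl big_ord0 addr0; congr (f _ + f _); apply: val_inj.
Qed.

Lemma sum4E (V : nmodType) (f : 'I_4 -> V) : \sum_i f i = f 0 + f 1 + f 2 + f 3.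
Proof.
rewrite !big_ord_recl big_ord0 addr0 !addrA.
by congr (f _ + f _ + f _ + f _); apply: val_inj.
Qed.

Lemma ord3P (j : 'I_3) : [\/ j = 0, j = 1 | j = 2].
Proof.
by case: j => [[|[|[|//]]] ?];
  [apply: Or31|apply: Or32|apply: Or33]; apply: val_inj.
Qed.

Lemma sum3E (V : nmodType) (f : 'I_3 -> V) : \sum_i f i = f 0 + f 1 + f 2.
Proof.
rewrite !big_ord_recl big_ord0 addr0 addrA.
by congr (f _ + f _ + f _); apply: val_inj.
Qed.

(** * Affine changes of variables in the plane *)
Section AffineMeasure.
Variable R : realType.
Notation lambda := (@lebesgue_measure R).

(** Both sides are measures in A once the factor is moved to the left, so
    comparing them on half-open intervals suffices. *)
Lemma lebesgue_measure_affine (c b : R) (A : set R) : c != 0 -> measurable A ->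
  lambda ((fun y => c * y + b) @^-1` A) = (`|c|^-1%:E * lambda A)%E.
Proof.
move=> c0 mA.
have nc0 : 0 < `|c| by rewrite normr_gt0.
pose f (y : measurableTypeR R) : measurableTypeR R := c * y + b.
have mf : measurable_fun setT f.
  by apply: measurable_funD => //; exact: measurable_funM.
pose P := measure_function_pushforward__canonical__measure_function_Measure lambda mf.
suff -> : lambda A = mscale (NngNum (ltW nc0)) P A.
  by rewrite /mscale /= /pushforward muleA -EFinM mulVf ?mul1e// gt_eqF.
apply: lebesgue_measure_unique => // _ [[u v] _ <-].
rewrite /= /mscale /= /pushforward /=.
have [c_gt0|c_lt0|c00] := ltgtP 0 c; last by rewrite -c00 eqxx in c0.
  have -> : f @^-1` `]u, v] = [set` `](u - b) / c, (v - b) / c]].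
    apply/seteqP; split => y /=; rewrite !in_itv /= /f.
      by rewrite ltr_pdivrMr// ler_pdivlMr// mulrC ltrBlDr lerBrDr.
    by rewrite ltr_pdivrMr// ler_pdivlMr// mulrC ltrBlDr lerBrDr.
  rewrite !lebesgue_measure_itv /= !lte_fin ltr_pM2r ?invr_gt0// ltrD2r.
  case: ifP => _; last by rewrite mule0.
  rewrite -!EFinD -EFinM gtr0_norm//; congr EFin.
  by field.
have -> : f @^-1` `]u, v] = [set` `[(v - b) / c, (u - b) / c[].
  apply/seteqP; split => y /=; rewrite !in_itv /= /f.
    by rewrite ltr_ndivlMr// ler_ndivrMr// mulrC ltrBlDr lerBrDr andbC.
  by rewrite ltr_ndivlMr// ler_ndivrMr// mulrC ltrBlDr lerBrDr andbC.
rewrite !lebesgue_measure_itv /= !lte_fin ltr_nM2r ?invr_lt0// ltrD2r.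
case: ifP => _; last by rewrite mule0.
rewrite -!EFinD -EFinM ltr0_norm//; congr EFin.
by field.
Qed.

Notation pm := (@plane_measure R).
Notation plane := (measurableTypeR R * measurableTypeR R)%type.

(** For an affine bijection f the factor k is the inverse of the absolute
    determinant. *)
Definition scales_area (k : R) (f : plane -> plane) : Prop :=
  [/\ measurable_fun setT f, 0 < k &
      forall A, measurable A -> pm (f @^-1` A) = (k%:E * pm A)%E].

Lemma scales_area_comp k l f g :
  scales_area k f -> scales_area l g -> scales_area (l * k) (f \o g).
Proof.
move=> [mf k0 fE] [mg l0 gE]; split.
- exact: measurableT_comp.
- exact: mulr_gt0.
- move=> A mA; rewrite comp_preimage gE ?fE// 1?muleA ?EFinM//.
  by rewrite -[X in measurable X]setTI; exact: mf.
Qed.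

Lemma measurable_affine_form (a c b : R) :
  measurable_fun setT (fun x : plane => a * x.1 + c * x.2 + b).
Proof.
apply: measurable_funD => //.
by apply: measurable_funD; apply: measurable_funM.
Qed.

(** By definition of the product measure it suffices to look at the sections
    over each first coordinate, where the map is affine on the line. *)
Lemma scales_area_shear2 (a c b : R) : c != 0 ->
  scales_area `|c|^-1 (fun x : plane => (x.1, a * x.1 + c * x.2 + b) : plane).
Proof.
move=> c0; split.
- apply/measurable_fun_pairP; split; first exact: measurable_fst.
  exact: measurable_affine_form.
- by rewrite invr_gt0 normr_gt0.
- move=> A mA; rewrite /plane_measure /= /product_measure1.
  rewrite -ge0_integralZl//; last exact: measurable_fun_xsection.
  apply: eq_integral => x _ /=.
  rewrite -(lebesgue_measure_affine (a * x + b) c0); last exact: measurable_xsection.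
  congr lebesgue_measure; apply/seteqP; split => y; rewrite /xsection /= !inE /=;
    by rewrite addrAC addrC.
Qed.

(** The mirror image of the preceding lemma, for which the product measure has
    to be computed by sections over the second coordinate. *)
Lemma scales_area_shear1 (a c b : R) : a != 0 ->
  scales_area `|a|^-1 (fun x : plane => (a * x.1 + c * x.2 + b, x.2) : plane).
Proof.
move=> a0.
have mf : measurable_fun setT (fun x : plane => (a * x.1 + c * x.2 + b, x.2) : plane).
  apply/measurable_fun_pairP; split; last exact: measurable_snd.
  exact: measurable_affine_form.
split => //.
- by rewrite invr_gt0 normr_gt0.
- have pmE A : measurable A -> pm A = (lambda \x^ lambda)%E A.
    by apply: product_measure_unique => B C mB mC; exact: product_measure2E.
  move=> A mA; rewrite !pmE//; last first.
    by rewrite -[X in measurable X]setTI; exact: mf.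
  rewrite /product_measure2.
  rewrite -ge0_integralZl//; last exact: measurable_fun_ysection.
  apply: eq_integral => x _ /=.
  rewrite -(lebesgue_measure_affine (c * x + b) a0); last exact: measurable_ysection.
  congr lebesgue_measure; apply/seteqP; split => y; rewrite /ysection /= !inE /=;
    by rewrite addrA.
Qed.

(** A matrix with nonzero upper left entry is a product of two shears of the
    kinds above; adding the second column to the first, which is again a shear,
    reduces the general case to this one. *)
Lemma scales_area_affine (a b c d e f : R) : a * d - b * c != 0 ->
  exists k, scales_area k
    (fun x : plane => (a * x.1 + b * x.2 + e, c * x.1 + d * x.2 + f) : plane).
Proof.
have core (a' b' c' d' : R) : a' != 0 -> a' * d' - b' * c' != 0 ->
    exists k, scales_area k (fun x : plane =>
      (a' * x.1 + b' * x.2 + e, c' * x.1 + d' * x.2 + f) : plane).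
  move=> a0 det0.
  have s0 : d' - b' * c' / a' != 0.
    rewrite -[d'](mulfK a0) -mulrBl mulf_neq0 ?invr_neq0//.
    by rewrite [d' * a']mulrC.
  have := scales_area_comp (scales_area_shear2 (c' / a') (f - c' * e / a') s0)
    (scales_area_shear1 b' e a0).
  set k := _ * _ => H; exists k; congr scales_area: H.
  by apply/funext => x /=; congr pair; field.
have [a0|a0] := eqVneq a 0; last exact: core.
move=> det0.
have b0 : b != 0 by apply: contraNneq det0 => ->; rewrite a0 !mul0r subr0.
(* The map is the composition of the one below with (x, y) |-> (x, x + y). *)
have [||k Hk] := core (a - b) b (c - d) d.
- by rewrite a0 sub0r oppr_eq0.
- by apply: contra_neq det0 => <-; ring.
have := scales_area_comp Hk (scales_area_shear2 1 0 (oner_neq0 R)).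
set k' := _ * _ => H; exists k'; congr scales_area: H.
by apply/funext => x /=; congr pair; ring.
Qed.

(** Positive and negative parts are transformed separately.  Multiplication by
    k > 0 distributes over the difference of their integrals, infinite or not, so
    measurability of g suffices. *)
Lemma Rintegral_scales_area k (f : plane -> plane) (D : set plane)
    (g : plane -> R) : scales_area k f -> measurable D ->
    measurable_fun setT g ->
  \int[pm]_(x in f @^-1` D) g (f x) = k * \int[pm]_(x in D) g x.
Proof.
move=> [mf k0 fE] mD mg.
have ge0 (h : plane -> \bar R) : measurable_fun setT h ->
    (forall x, 0 <= h x)%E ->
    (\int[pm]_(x in f @^-1` D) h (f x) = k%:E * \int[pm]_(x in D) h x)%E.
  move=> mh h0.
  rewrite -[LHS](@ge0_integral_pushforward _ _ _ _ _ f mf pm D h)//; last first.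
    exact: measurable_funTS.
  rewrite (eq_measure_integral (mscale (NngNum (ltW k0)) pm)).
    by rewrite ge0_integral_mscale//; exact: measurable_funTS.
  by move=> A mA _; exact: fE.
have mEg : measurable_fun setT (EFin \o g) by exact/measurable_EFinP.
have [mp mn] := (measurable_funepos mEg, measurable_funeneg mEg).
have kM (u v : \bar R) : (0 <= u -> 0 <= v -> k%:E * u - k%:E * v = k%:E * (u - v))%E.
  by case: u => [u||]; case: v => [v||] //= _ _;
    rewrite ?(gt0_muley, gt0_muleNy, lte_fin)// -!EFinM -EFinB mulrBr.
have kfine (u : \bar R) : fine (k%:E * u)%E = k * fine u.
  by case: u => [u||] //=; rewrite ?(gt0_muley, gt0_muleNy, lte_fin)//= mulr0.
rewrite /Rintegral -kfine [X in fine (_ * X)]integralE -kM; try exact: integral_ge0.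
by rewrite -!ge0// [in LHS]integralE; congr fine; congr (_ - _)%E;
  apply: eq_integral => x _; rewrite ?funeposE ?funenegE.
Qed.

End AffineMeasure.

(** * Moments of the reference simplex *)
Section Moments.
Variable R : realType.
Notation lambda := (@lebesgue_measure R).
Notation pm := (@plane_measure R).
Notation plane := (measurableTypeR R * measurableTypeR R)%type.

Definition simplex : set (R * R) := [set y | [/\ 0 <= y.1, 0 <= y.2 & y.1 + y.2 <= 1]].

Lemma measurable_simplex : measurable (simplex : set plane).
Proof.
have -> : simplex = [set y : plane | 0 <= y.1] `&` [set y : plane | 0 <= y.2]
    `&` [set y : plane | y.1 + y.2 <= 1].
  by apply/seteqP; split => y; [case => ? ? ?|case => -[? ?] ?].
have mle (f g : plane -> R) : measurable_fun setT f -> measurable_fun setT g ->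
    measurable [set y | f y <= g y].
  move=> mf mg; rewrite -[X in measurable X]setTI.
  have := measurable_fun_ler mf mg.
  by move=> /(_ measurableT [set true] I); rewrite preimage_true.
apply: measurableI; [apply: measurableI|]; apply: mle => //.
exact: measurable_funD.
Qed.

Definition moment (i j : nat) : R := (i`! * j`!)%:R / (i + j + 2)`!%:R.

Lemma integral_segmentX (c : R) (j : nat) : 0 <= c ->
  (\int[lambda]_(y in `[0%R, c]) (y ^+ j)%:E = (c ^+ j.+1 / j.+1%:R)%:E)%E.
Proof.
rewrite le_eqVlt => /predU1P[<-|c0].
  by rewrite expr0n mul0r set_itv1 integral_set1.
rewrite (@continuous_FTC2 _ _ (fun x => x ^+ j.+1 / j.+1%:R))//=.
- by rewrite expr0n mul0r oppr0 addr0.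
- by apply: continuous_subspaceT => x; exact: exprn_continuous.
- split.
  + by move=> x _; apply: derivableM => //; exact: exprn_derivable.
  + apply: cvg_at_right_filter; apply: cvgM; last exact: cvg_cst.
    exact: exprn_continuous.
  + apply: cvg_at_left_filter; apply: cvgM; last exact: cvg_cst.
    exact: exprn_continuous.
- move=> x _; rewrite derive1Mr//; last exact: exprn_derivable.
  by rewrite derive1E exp_derive scaler1 mulrAC divff// mul1r.
Qed.

(** By Tonelli the integral over the second coordinate leaves a Beta integral in
    the first one. *)
Lemma integral_simplex_monomial i j :
  (\int[pm]_(x in simplex) (x.1 ^+ i * x.2 ^+ j)%:E = (moment i j)%:E)%E.
Proof.
pose f (x : plane) : \bar R := (x.1 ^+ i * x.2 ^+ j)%:E.
have mf : measurable_fun setT f.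
  by apply/measurable_EFinP; apply: measurable_funM; exact: measurable_funX.
rewrite integral_mkcond.
rewrite fubini_tonelli1; last 2 first.
  apply/measurable_restrict => //; first exact: measurable_simplex.
  exact: measurable_funS mf.
  move=> x; rewrite /patch; case: ifPn => // /set_mem[x0 y0 _].
  by rewrite lee_fin mulr_ge0 ?exprn_ge0.
transitivity (\int[lambda]_(x in `[0%R, 1%R]) (XMonemX i j.+1 x / j.+1%:R)%:E)%E.
  rewrite [RHS]integral_mkcond; apply: eq_integral => x _.
  rewrite /fubini_F /patch.
  case: ifPn => [/set_mem/=|xI].
    rewrite in_itv /= => /andP[x0 x1].
    transitivity (\int[lambda]_(y in `[0%R, (1 - x)%R]) ((x ^+ i)%:E * (y ^+ j)%:E))%E.
      rewrite [RHS]integral_mkcond; apply: eq_integral => y _.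
      rewrite /patch mem_setE EFinM.
      have -> // : ((x, y) \in simplex) = (y \in `[0, 1 - x]).
      rewrite in_itv /=; apply/idP/idP.
        by move=> /set_mem[/= _ y0 xy]; apply/andP; split; lra.
      by move=> /andP[y0 xy]; apply/mem_set; split => //=; lra.
    rewrite ge0_integralZl//; last 3 first.
    - by apply/measurable_EFinP; apply: measurable_funTS; exact: measurable_funX.
    - by move=> y /=; rewrite in_itv /= => /andP[y0 _]; rewrite lee_fin exprn_ge0.
    - by rewrite lee_fin exprn_ge0.
    by rewrite integral_segmentX ?subr_ge0// -EFinM mulrA.
  rewrite integral0_eq// => y _.
  case: ifPn => // /set_mem[/= x0 y0 xy]; move: xI; rewrite notin_setE /= in_itv /=.
  by case; apply/andP; split => //; lra.
have mXM := @measurable_XMonemX R `[0, 1] i j.+1.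
transitivity ((j.+1%:R^-1)%:E * \int[lambda]_(x in `[0%R, 1%R]) (XMonemX i j.+1 x)%:E)%E.
  rewrite -ge0_integralZl//.
  - by apply: eq_integral => x _; rewrite -EFinM mulrC.
  - exact/measurable_EFinP.
  - by move=> x x01; rewrite lee_fin XMonemX_ge0.
have := @EFin_beta_fun R i.+1 j.+2.
rewrite integral_XMonemX_restrict setTI /= => <-.
rewrite beta_fun_fact -EFinM; congr EFin.
have nz n : n`!%:R != 0 :> R by rewrite pnatr_eq0 -lt0n fact_gt0.
rewrite /moment !addnS addn0; move: (i + j).+2`! (nz (i + j).+2) => m m0.
rewrite factS !natrM.
by field; rewrite m0 nat1r pnatr_eq0.
Qed.

Lemma integrable_simplex_monomial i j :
  pm.-integrable simplex (fun x : plane => (x.1 ^+ i * x.2 ^+ j)%:E).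
Proof.
apply/integrableP; split.
  apply/measurable_EFinP; apply: measurable_funTS.
  by apply: measurable_funM; exact: measurable_funX.
rewrite (eq_integral (fun x : plane => (x.1 ^+ i * x.2 ^+ j)%:E)).
  by rewrite integral_simplex_monomial ltry.
move=> x /set_mem[x0 y0 _]; rewrite /= ger0_norm//.
by rewrite mulr_ge0 ?exprn_ge0.
Qed.

End Moments.

(** * Polynomial functions on the plane *)
Section Polynomials.
Variable R : realType.
Implicit Types (f g : R * R -> R) (x y : R * R).

Lemma Pol0 k : @Pol R k (fun=> 0).
Proof.
exists (fun _ _ => 0) => x.
by rewrite big1// => i _; rewrite big1// => j _; rewrite !mul0r.
Qed.

Lemma Pol_lin k a f g : Pol k f -> Pol k g -> Pol k (fun x => f x + a * g x).
Proof.
move=> [c fE] [d gE]; exists (fun i j => c i j + a * d i j) => x.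
rewrite fE gE mulr_sumr -big_split; apply: eq_bigr => i _.
rewrite mulr_sumr -big_split; apply: eq_bigr => j _ /=.
by rewrite !mulrDl !mulrA.
Qed.

Lemma PolD k f g : Pol k f -> Pol k g -> Pol k (fun x => f x + g x).
Proof.
move=> /Pol_lin fP /fP => /(_ 1).
by congr Pol; apply/funext => x; rewrite mul1r.
Qed.

Lemma PolZ k a f : Pol k f -> Pol k (fun x => a * f x).
Proof.
move=> /(Pol_lin a (Pol0 k)).
by congr Pol; apply/funext => x; rewrite add0r.
Qed.

Lemma PolB k f g : Pol k f -> Pol k g -> Pol k (fun x => f x - g x).
Proof.
move=> /Pol_lin fP /fP => /(_ (- 1)).
by congr Pol; apply/funext => x; rewrite mulN1r.
Qed.

Lemma Pol_monomial k i j : (i + j <= k)%N -> @Pol R k (fun x => x.1 ^+ i * x.2 ^+ j).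
Proof.
move=> ijk; have [ik jk] : (i < k.+1)%N /\ (j < k.+1)%N.
  by split; rewrite ltnS (leq_trans _ ijk)// ?leq_addr ?leq_addl.
exists (fun i' j' => ((i' == i) && (j' == j))%:R) => x.
rewrite (bigD1 (Ordinal ik))//= [X in _ + X]big1 => [|i' /negPf i'i]; last first.
  rewrite big1// => j' _.
  have -> : (i' == i :> nat) = false by rewrite -i'i.
  by rewrite !mul0r.
rewrite (bigD1 (Ordinal jk))//= big1 => [|j' /andP[_ /negPf j'j]].
  by rewrite !eqxx mul1r !addr0.
have -> : (j' == j :> nat) = false by rewrite -j'j.
by rewrite andbF !mul0r.
Qed.

(** The induction principle by which linear statements about polynomials are
    reduced to monomials.  The hypotheses f, g in P_k are kept in the linear step
    because integrals and derivatives are additive only under such conditions. *)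
Lemma Pol_ind k (P : (R * R -> R) -> Prop) :
  P (fun=> 0) ->
  (forall a f g, Pol k f -> Pol k g -> P f -> P g -> P (fun x => f x + a * g x)) ->
  (forall i j, (i + j <= k)%N -> P (fun x => x.1 ^+ i * x.2 ^+ j)) ->
  forall f, Pol k f -> P f.
Proof.
move=> P0 Plin Pmono f [c fE].
pose P' f := Pol k f /\ P f.
have lin a f1 f2 : P' f1 -> P' f2 -> P' (fun x => f1 x + a * f2 x).
  by move=> [? ?] [? ?]; split; [exact: Pol_lin|exact: Plin].
have Psum n (p : pred 'I_n) (F : 'I_n -> R * R -> R) :
    (forall i, p i -> P' (F i)) -> P' (fun x => \sum_(i | p i) F i x).
  move=> FP; elim: (index_enum _) => [|i r IH].
    have -> : (fun x => \sum_(i <- [::] | p i) F i x) = fun=> 0.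
      by apply/funext => x; rewrite big_nil.
    by split => //; exact: Pol0.
  have [pi|pi] := boolP (p i); last first.
    by congr P': IH; apply/funext => x; rewrite big_cons (negPf pi).
  have := lin 1 _ _ (FP i pi) IH.
  by congr P'; apply/funext => x; rewrite big_cons pi mul1r.
have [//] : P' f.
have -> : f = fun x => \sum_(i < k.+1) \sum_(j < k.+1 | (i + j <= k)%N)
    (0 + c i j * (x.1 ^+ i * x.2 ^+ j)).
  apply/funext => x; rewrite fE; apply: eq_bigr => i _; apply: eq_bigr => j _.
  by rewrite add0r mulrA.
apply: (Psum) => i _; apply: (Psum _ (fun j : 'I_k.+1 => (i + j <= k)%N)) => j ijk.
by apply: lin; split; [exact: Pol0|by []|exact: Pol_monomial|exact: Pmono].
Qed.

Lemma Pol_sum k n (f : 'I_n -> R * R -> R) :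
  (forall i, Pol k (f i)) -> Pol k (fun x => \sum_i f i x).
Proof.
move=> fP; elim: (index_enum _) => [|i r IH].
  by have := Pol0 k; congr Pol; apply/funext => x; rewrite big_nil.
have := PolD (fP i) IH.
by congr Pol; apply/funext => x; rewrite big_cons.
Qed.

Lemma Pol_leq k l f : (k <= l)%N -> Pol k f -> Pol l f.
Proof.
move=> kl; elim/Pol_ind; first exact: Pol0.
- by move=> a f1 f2 _ _; exact: Pol_lin.
- by move=> i j ijk; exact/Pol_monomial/(leq_trans ijk).
Qed.

Lemma Pol_cst k (a : R) : Pol k (fun=> a).
Proof.
have /(PolZ a) := @Pol_monomial k 0 0 isT.
by congr Pol; apply/funext => x; rewrite !expr0 !mulr1.
Qed.

Lemma Pol_fst k : @Pol R k.+1 fst.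
Proof.
have := @Pol_monomial k.+1 1 0 isT.
by congr Pol; apply/funext => x; rewrite expr1 mulr1.
Qed.

Lemma Pol_snd k : @Pol R k.+1 snd.
Proof.
have := @Pol_monomial k.+1 0 1 isT.
by congr Pol; apply/funext => x; rewrite expr1 mul1r.
Qed.

Lemma PolM k l f g : Pol k f -> Pol l g -> Pol (k + l) (fun x => f x * g x).
Proof.
move=> + gP; elim/Pol_ind => [|a f1 f2 _ _ f1P f2P|i j ijk].
- by have := Pol0 (k + l); congr Pol; apply/funext => x; rewrite mul0r.
- have := Pol_lin a f1P f2P.
  by congr Pol; apply/funext => x; rewrite mulrDl mulrA.
move: gP; elim/Pol_ind => [|a f1 f2 _ _ f1P f2P|i' j' ijl].
- by have := Pol0 (k + l); congr Pol; apply/funext => x; rewrite mulr0.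
- have := Pol_lin a f1P f2P.
  by congr Pol; apply/funext => x; rewrite mulrDr mulrCA.
have /Pol_monomial : (i + i' + (j + j') <= k + l)%N by rewrite addnACA leq_add.
by congr Pol; apply/funext => x; rewrite !exprD mulrACA.
Qed.

Lemma PolX k n f : Pol k f -> Pol (n * k) (fun x => f x ^+ n).
Proof.
move=> fP; elim: n => [|n IH]; first exact: Pol_cst.
have := PolM fP IH; rewrite -mulSn.
by congr Pol; apply/funext => x; rewrite exprS.
Qed.

Lemma Pol_comp k f (u v : R * R -> R) : Pol 1 u -> Pol 1 v -> Pol k f ->
  Pol k (fun x => f (u x, v x)).
Proof.
move=> uP vP; elim/Pol_ind => [|a f1 f2 _ _|i j ijk]; first exact: Pol0.
- exact: Pol_lin.
- apply: Pol_leq ijk _.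
  by have := PolM (PolX i uP) (PolX j vP); rewrite !muln1.
Qed.

(** Restricting to lines turns questions about bivariate polynomial functions
    into questions about formal univariate polynomials. *)
Lemma Pol_line k f x v : Pol k f ->
  exists p : {poly R}, forall t, f (x + t *: v) = p.[t].
Proof.
elim/Pol_ind => [|a f1 f2 _ _ [p pE] [q qE]|i j _].
- by exists 0 => t; rewrite horner0.
- by exists (p + a *: q) => t; rewrite hornerD hornerZ pE qE.
- exists ((x.1%:P + v.1 *: 'X) ^+ i * (x.2%:P + v.2 *: 'X) ^+ j) => t.
  by rewrite !hornerE /= (mulrC v.1) (mulrC v.2).
Qed.

End Polynomials.

(** * Directional derivatives of polynomials *)
Section Derivatives.
Variable R : realType.
Implicit Types (f g : R * R -> R) (x y : R * R).

(** A directional derivative sees the function only on one line, so it can be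
    computed by formal differentiation. *)
Lemma derive_line f x v (p : {poly R}) : (forall t, f (x + t *: v) = p.[t]) ->
  'D_v f x = p^`().[0].
Proof.
move=> fp.
transitivity (derive1 (horner p) 0).
  rewrite /derive /derive1.
  set d1 := (fun _ : R => _); set d2 := (fun _ : R => _).
  suff -> : d1 = d2 by [].
  apply/funext => h; rewrite /d1 /d2 /=.
  by rewrite addr0 [h *: v + x]addrC fp; have := fp 0; rewrite scale0r addr0 => ->.
by rewrite derivE.
Qed.

Lemma derive_lin k a f g x v : Pol k f -> Pol k g ->
  'D_v (fun y => f y + a * g y) x = 'D_v f x + a * 'D_v g x.
Proof.
move=> /(Pol_line x v)[p pE] /(Pol_line x v)[q qE].
rewrite (derive_line pE) (derive_line qE) (@derive_line _ _ _ (p + a *: q)).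
  by rewrite derivD derivZ hornerD hornerZ.
by move=> t; rewrite pE qE hornerD hornerZ.
Qed.

Lemma derive_monomial i j x v : 'D_v (fun y : R * R => y.1 ^+ i * y.2 ^+ j) x =
  v.1 * (i%:R * x.1 ^+ i.-1 * x.2 ^+ j) + v.2 * (j%:R * x.1 ^+ i * x.2 ^+ j.-1).
Proof.
pose l (a b : R) : {poly R} := a%:P + b *: 'X.
have lE a b n : ((l a b) ^+ n)^`().[0] = n%:R * a ^+ n.-1 * b.
  rewrite deriv_exp /l derivD derivC derivZ derivX add0r.
  rewrite hornerMn hornerM horner_exp !hornerE /=.
  by rewrite -[RHS]mulrA mulr_natl mulrC.
rewrite (@derive_line _ _ _ (l x.1 v.1 ^+ i * l x.2 v.2 ^+ j)).
  rewrite derivM hornerD !hornerM !lE !horner_exp /l !hornerE /=.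
  by ring.
by move=> t; rewrite /l !hornerE /= (mulrC v.1) (mulrC v.2).
Qed.

Lemma Pol_derive k f v : Pol k.+1 f -> Pol k (fun x => 'D_v f x).
Proof.
elim/Pol_ind => [|a f1 f2 f1P f2P d1 d2|i j ijk].
- by have := Pol0 R k; congr Pol; apply/funext => x; rewrite derive_cst.
- have := Pol_lin a d1 d2; congr Pol; apply/funext => x.
  by rewrite (derive_lin _ _ _ f1P f2P).
- rewrite [X in Pol k X](_ : _ = fun x =>
      (v.1 * i%:R) * (x.1 ^+ i.-1 * x.2 ^+ j) +
      (v.2 * j%:R) * (x.1 ^+ i * x.2 ^+ j.-1)); last first.
    by apply/funext => x; rewrite derive_monomial; ring.
  apply: PolD.
    case: i ijk => [|i] ijk; last exact/PolZ/Pol_monomial.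
    by have := Pol0 R k; congr Pol; apply/funext => x; rewrite mulr0 mul0r.
  case: j ijk => [|j] ijk; last by apply/PolZ/Pol_monomial; rewrite addnS in ijk.
  by have := Pol0 R k; congr Pol; apply/funext => x; rewrite mulr0 mul0r.
Qed.

Lemma derive_cst (a : R) x v : 'D_v (fun=> a) x = 0.
Proof.
by rewrite (@derive_line _ _ _ a%:P) ?derivC ?horner0// => t; rewrite hornerC.
Qed.

Lemma derive_dir k f x a b u v : Pol k f ->
  'D_(a *: u + b *: v) f x = a * 'D_u f x + b * 'D_v f x.
Proof.
elim/Pol_ind => [|c f1 f2 f1P f2P d1 d2|i j ijk].
- by rewrite !derive_cst !mulr0 addr0.
- rewrite !(derive_lin _ _ _ f1P f2P) d1 d2; ring.
-
  by rewrite !derive_monomial /= !scaleRE; ring.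
Qed.

(** On a line through the interior point (1/4, 1/4) the polynomial has
    infinitely many zeros. *)
Lemma Pol_eq0_simplex k f :
  Pol k f -> (forall y, simplex y -> f y = 0) -> forall y, f y = 0.
Proof.
move=> fP f0 y; pose c : R * R := (4^-1, 4^-1).
have [p pE] := Pol_line c (y - c) fP.
suff p0 : p = 0.
  by have := pE 1; rewrite p0 horner0 scale1r addrC subrK.
apply/eqP; apply/negPn/negP => p0.
pose w1 := y.1 - 4^-1; pose w2 := y.2 - 4^-1.
(* For 0 < t <= 1 / M the point c + t (y - c) lies in the simplex. *)
pose M := 4 * (1 + `|w1| + `|w2|).
have M0 : 0 < M.
  by rewrite mulr_gt0// -addrA ltr_wpDr// addr_ge0.
pose r n : R := (M * n.+1%:R)^-1.
have /(max_poly_roots p0) : all (root p) [seq r i | i <- iota 0 (size p)].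
  apply/allP => _ /mapP[n _ ->]; rewrite /root -pE; apply/eqP/f0.
  have rn0 : 0 < r n by rewrite invr_gt0 mulr_gt0// ltr0n.
  have rM : r n * M <= 1.
    rewrite /r invfM mulrC mulrA divff ?gt_eqF// mul1r invf_le1 ?ltr0n//.
    by rewrite ler1n.
  have bnd (z : R) : `|r n * z| <= r n * `|z| by rewrite normrM gtr0_norm.
  suff: [/\ 0 <= 4^-1 + r n * w1, 0 <= 4^-1 + r n * w2 &
    4^-1 + r n * w1 + (4^-1 + r n * w2) <= 1] by [].
  move: (bnd w1) (bnd w2) rM; rewrite !ler_norml /M !mulrDr mulr1.
  rewrite ![r n * (4 * _)]mulrCA.
  move: (r n * w1) (r n * w2) (r n * `|w1|) (r n * `|w2|) => a1 a2 b1 b2.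
  by move=> /andP[? ?] /andP[? ?] ?; split; lra.
rewrite size_map size_iota ltnn => H.
apply: notF; apply: H.
rewrite map_inj_uniq ?iota_uniq// => m n /invr_inj.
move=> /(mulfI (lt0r_neq0 M0)) /eqP; rewrite eqr_nat => /eqP [].
by [].
Qed.

End Derivatives.

(** * The divergence theorem on the reference simplex *)
Section PolynomialIntegrals.
Variable R : realType.
Implicit Types (f g : R * R -> R) (x y : R * R).
Notation lambda := (@lebesgue_measure R).
Notation pm := (@plane_measure R).
Notation plane := (measurableTypeR R * measurableTypeR R)%type.

Let fact0R n : n`!%:R != 0 :> R. Proof. by rewrite pnatr_eq0 -lt0n fact_gt0. Qed.

Definition simplex_int f : R := \int[pm]_(x in @simplex R) f x.

Lemma Pol_measurable k f : Pol k f -> measurable_fun setT (f : plane -> R).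
Proof.
elim/Pol_ind => [|a f1 f2 _ _ d1 d2|i j _].
- exact: measurable_cst.
- by apply: measurable_funD => //; exact: measurable_funM.
- by apply: measurable_funM; exact: measurable_funX.
Qed.

Lemma Pol_integrable k f : Pol k f ->
  pm.-integrable (@simplex R) (EFin \o f).
Proof.
have mS := @measurable_simplex R.
elim/Pol_ind => [|a f1 f2 _ _ d1 d2|i j _].
- exact: integrable0.
- rewrite (_ : EFin \o _ = (EFin \o f1) \+ (fun x => a%:E * (EFin \o f2) x)%E)//.
  by apply: integrableD => //; exact: integrableZl.
- exact: integrable_simplex_monomial.
Qed.

Lemma simplex_int_lin k a f g : Pol k f -> Pol k g ->
  simplex_int (fun x => f x + a * g x) = simplex_int f + a * simplex_int g.
Proof.
move=> fP gP; have mS := @measurable_simplex R.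
have fI := Pol_integrable fP; have gI := Pol_integrable gP.
rewrite /simplex_int RintegralD//; first by rewrite RintegralZl.
exact: (integrableZl mS a gI).
Qed.

Lemma simplex_int_monomial i j :
  simplex_int (fun x => x.1 ^+ i * x.2 ^+ j) = moment R i j.
Proof. by rewrite /simplex_int /Rintegral integral_simplex_monomial. Qed.

Lemma simplex_int0 : simplex_int (fun=> 0) = 0.
Proof. by rewrite /simplex_int Rintegral_cst ?mul0r//; exact: measurable_simplex. Qed.

Lemma simplex_intZ k a f : Pol k f ->
  simplex_int (fun x => a * f x) = a * simplex_int f.
Proof.
move=> fP; rewrite -[RHS]add0r -simplex_int0 -(simplex_int_lin _ (Pol0 R k) fP).
by congr simplex_int; apply/funext => x; rewrite add0r.
Qed.

Lemma simplex_intD k f g : Pol k f -> Pol k g ->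
  simplex_int (fun x => f x + g x) = simplex_int f + simplex_int g.
Proof.
move=> fP gP; rewrite -[simplex_int g]mul1r -(simplex_int_lin _ fP gP).
by congr simplex_int; apply/funext => x; rewrite mul1r.
Qed.

Lemma simplex_int_sum k n (c : 'I_n -> R) (f : 'I_n -> R * R -> R) :
  (forall i, Pol k (f i)) ->
  simplex_int (fun x => \sum_i c i * f i x) = \sum_i c i * simplex_int (f i).
Proof.
move=> fP; suff [] : Pol k (fun x => \sum_i c i * f i x) /\
    simplex_int (fun x => \sum_i c i * f i x) = \sum_i c i * simplex_int (f i) by [].
elim: (index_enum _) => [|i r [rP IH]].
  under eq_fun do rewrite big_nil.
  by rewrite big_nil simplex_int0; split => //; exact: Pol0.
under eq_fun do rewrite big_cons.
rewrite big_cons -IH -(simplex_intZ _ (fP i)) -(simplex_intD (PolZ (c i) (fP i)) rP).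
by split => //; apply: PolD => //; exact: PolZ.
Qed.

Definition line_int f x v : R := \int[lambda]_(t in `[0, 1]) f (x + t *: v).

Lemma line_int_lin k a f g x v : Pol k f -> Pol k g ->
  line_int (fun y => f y + a * g y) x v = line_int f x v + a * line_int g x v.
Proof.
have lineI h : Pol k h ->
    lambda.-integrable `[0, 1] (EFin \o (fun t => h (x + t *: v))).
  move=> /(Pol_line x v)[p pE].
  apply: continuous_compact_integrable; first exact: segment_compact.
  apply: continuous_subspaceT; rewrite (_ : (fun t => _) = horner p).
    exact: continuous_horner.
  exact/funext.
move=> /lineI fI gP; have gI := lineI _ gP.
rewrite /line_int RintegralD//; first by rewrite RintegralZl.
exact: (lineI _ (PolZ a gP)).
Qed.

Lemma line_int_hypotenuse i j :
  line_int (fun y => y.1 ^+ i * y.2 ^+ j) (1, 0) (-1, 1) =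
  (i`! * j`!)%:R / (i + j).+1`!%:R.
Proof.
rewrite mulnC addnC -beta_fun_fact /beta_fun -Rintegral_mkcond.
apply: eq_Rintegral => t _; rewrite /XMonemX /= add0r mulrC.
by congr (_ ^+ _ * _ ^+ _); rewrite ?[t%:A]mulr1 ?[t *: -1]mulrN1.
Qed.

Lemma line_int_vertical i j :
  line_int (fun y => y.1 ^+ i * y.2 ^+ j) 0 (0, 1) =
  if i == 0 then j.+1%:R^-1 else 0.
Proof.
case: i => [|i] /=.
  have := @beta_fun_fact R j 0; rewrite fact0 muln1 addn0.
  rewrite /beta_fun -Rintegral_mkcond factS natrM.
  rewrite invfM mulrCA mulfV ?mulr1 ?pnatr_eq0 -?lt0n ?fact_gt0// => <-.
  apply: eq_Rintegral => t _; rewrite /XMonemX /= add0r mul1r mulr1.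
  by rewrite add0r [t%:A]mulr1.
rewrite -[RHS](mul0r (fine (lambda `[0, 1]))) -Rintegral_cst//.
by apply: eq_Rintegral => t _; rewrite /= add0r scaler0 exprS !mul0r.
Qed.

Lemma line_int_horizontal i j :
  line_int (fun y => y.1 ^+ i * y.2 ^+ j) 0 (1, 0) =
  if j == 0 then i.+1%:R^-1 else 0.
Proof.
rewrite -line_int_vertical; apply: eq_Rintegral => t _ /=.
by rewrite mulrC.
Qed.

(** Green's formula for the first coordinate: only the hypotenuse and the
    vertical leg contribute.  For monomials it is an identity between Beta
    integrals. *)
Lemma simplex_int_derive1 k f : Pol k.+1 f ->
  simplex_int (fun x => 'D_(1, 0) f x) =
  line_int f (1, 0) (-1, 1) - line_int f 0 (0, 1).
Proof.
elim/Pol_ind => [|a f1 f2 f1P f2P d1 d2|i j _].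
- under [X in simplex_int X]eq_fun do rewrite derive_cst.
  by rewrite simplex_int0 /line_int Rintegral_cst// mul0r subrr.
- under [X in simplex_int X]eq_fun do rewrite (derive_lin _ _ _ f1P f2P).
  rewrite (simplex_int_lin _ (Pol_derive _ f1P) (Pol_derive _ f2P)) d1 d2.
  rewrite (line_int_lin a (1, 0) _ f1P f2P) (line_int_lin a 0 (0, 1) f1P f2P).
  by rewrite mulrBr opprD addrACA.
under [X in simplex_int X]eq_fun => x.
  rewrite derive_monomial /= mul0r addr0 mul1r -mulrA.
  over.
rewrite line_int_hypotenuse line_int_vertical.
rewrite (simplex_intZ _ (Pol_monomial _ (leqnn (i.-1 + j)))) simplex_int_monomial.
case: i => [|i] /=.
  rewrite mul0r fact0 mul1n add0n factS natrM.
  by field; rewrite fact0R nat1r pnatr_eq0.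
by rewrite subr0 /moment addn2 addSn mulrA -natrM mulnA -factS.
Qed.

Lemma simplex_int_derive2 k f : Pol k.+1 f ->
  simplex_int (fun x => 'D_(0, 1) f x) =
  line_int f (1, 0) (-1, 1) - line_int f 0 (1, 0).
Proof.
elim/Pol_ind => [|a f1 f2 f1P f2P d1 d2|i j _].
- under [X in simplex_int X]eq_fun do rewrite derive_cst.
  by rewrite simplex_int0 /line_int Rintegral_cst// mul0r subrr.
- under [X in simplex_int X]eq_fun do rewrite (derive_lin _ _ _ f1P f2P).
  rewrite (simplex_int_lin _ (Pol_derive _ f1P) (Pol_derive _ f2P)) d1 d2.
  rewrite (line_int_lin a (1, 0) _ f1P f2P) (line_int_lin a 0 (1, 0) f1P f2P).
  by rewrite mulrBr opprD addrACA.
under [X in simplex_int X]eq_fun => x.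
  rewrite derive_monomial /= mul0r add0r mul1r -mulrA.
  over.
rewrite line_int_hypotenuse line_int_horizontal.
rewrite (simplex_intZ _ (Pol_monomial _ (leqnn (i + j.-1)))) simplex_int_monomial.
case: j => [|j] /=.
  rewrite mul0r fact0 muln1 addn0 factS natrM.
  by field; rewrite fact0R nat1r pnatr_eq0.
by rewrite subr0 /moment addn2 addnS mulrA -natrM mulnCA -factS.
Qed.

(** The hypotheses say that the field (f, g) is tangential on the vertical leg,
    the horizontal leg and the hypotenuse, so that all boundary terms vanish. *)
Lemma simplex_int_divergence_tangential k f g : Pol k.+1 f -> Pol k.+1 g ->
    (forall t, 0 <= t <= 1 -> f (0, t) = 0) ->
    (forall t, 0 <= t <= 1 -> g (t, 0) = 0) ->
    (forall t, 0 <= t <= 1 -> f (1 - t, t) + g (1 - t, t) = 0) ->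
  simplex_int (fun x => 'D_(1, 0) f x + 'D_(0, 1) g x) = 0.
Proof.
move=> fP gP f0 g0 fg0.
have line0 h x v : (forall t, 0 <= t <= 1 -> h (x + t *: v) = 0) -> line_int h x v = 0.
  move=> h0; rewrite -[RHS](mul0r (fine (lambda `[0, 1]))) -Rintegral_cst//.
  by apply: eq_Rintegral => t /set_mem /=; rewrite in_itv /=; exact: h0.
rewrite (simplex_intD (Pol_derive _ fP) (Pol_derive _ gP)).
rewrite (simplex_int_derive1 fP) (simplex_int_derive2 gP).
rewrite [line_int f 0 _]line0 => [|t t01]; last first.
  rewrite -[RHS](f0 t t01) add0r; congr f.
  by rewrite [LHS]surjective_pairing /= scaler0 [t%:A]mulr1.
rewrite [line_int g 0 _]line0 => [|t t01]; last first.
  rewrite -[RHS](g0 t t01) add0r; congr g.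
  by rewrite [LHS]surjective_pairing /= scaler0 [t%:A]mulr1.
rewrite !subr0 -[line_int g _ _]mul1r -(line_int_lin _ _ _ fP gP) line0// => t t01.
rewrite mul1r -[RHS](fg0 t t01).
suff -> : (1, 0) + t *: (-1, 1) = (1 - t, t) :> R * R by [].
by rewrite [LHS]surjective_pairing /= add0r [t%:A]mulr1 [t *: -1]mulrN1.
Qed.

End PolynomialIntegrals.

(** * Affine charts of triangles *)
Section Triangles.
Variables (R : realType) (T : triangle R).
Implicit Types (f g : R * R -> R) (x y : R * R).
Notation plane := (measurableTypeR R * measurableTypeR R)%type.
Notation e1 := (T 1 - T 0).
Notation e2 := (T 2 - T 0).
Notation D := (affine_det T).
Notation F := (affine_map T).

Lemma affine_det_neq0 : D != 0.
Proof. exact: triangle_nondeg. Qed.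

(** The barycentric coordinates on the reference simplex. *)
Definition bary y (j : 'I_3) : R := [:: 1 - y.1 - y.2; y.1; y.2]`_j.

Lemma affine_mapE y : F y = (e1.1 * y.1 + e2.1 * y.2 + (T 0).1,
                             e1.2 * y.1 + e2.2 * y.2 + (T 0).2).
Proof.
rewrite /affine_map /affine_lin [LHS]surjective_pairing /=.
by congr pair; rewrite addrC [y.1 *: _]mulrC [y.2 *: _]mulrC.
Qed.

Lemma affine_map_bary y : F y = \sum_i bary y i *: T i.
Proof.
rewrite affine_mapE sum3E /bary [RHS]surjective_pairing /=.
by rewrite !scaleRE; congr pair; ring.
Qed.

Definition affine_inv x : R * R :=
  (cross (x - T 0) e2 / D, cross e1 (x - T 0) / D).

Lemma affine_invK : cancel affine_inv F.
Proof.
move=> x; rewrite affine_mapE /affine_inv [RHS]surjective_pairing /=.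
have := affine_det_neq0; rewrite /affine_det /cross /= => D0.
by congr pair; field.
Qed.

Lemma affine_mapK : cancel F affine_inv.
Proof.
move=> y; rewrite affine_mapE /affine_inv [RHS]surjective_pairing /=.
have := affine_det_neq0; rewrite /affine_det /cross /= => D0.
by congr pair; field.
Qed.

Lemma tri_set_affine y : tri_set T (F y) <-> simplex y.
Proof.
split=> [[t [t0 t1 Ft]]|[y1 y2 y12]].
  have <- : (t 1, t 2) = y.
    apply: (can_inj affine_mapK); rewrite Ft affine_map_bary; apply: eq_bigr => i _.
    congr (_ *: _); rewrite sum3E in t1.
    by have [->|->|->] := ord3P i; rewrite /bary //= -t1; ring.
  rewrite sum3E in t1.
  split => //=; have := t0 0; lra.
exists (bary y); split; last exact: affine_map_bary.
- by move=> i; have [->|->|->] := ord3P i; rewrite /bary //=; lra.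
- by rewrite sum3E /bary /=; ring.
Qed.

Lemma edge_affine y j : simplex y -> bary y j = 0 -> edge T j (F y).
Proof.
move=> [y1 y2 y12] yj.
exists (bary y); split => //; last exact: affine_map_bary.
- by move=> i; have [->|->|->] := ord3P i; rewrite /bary //=; lra.
- by rewrite sum3E /bary /=; ring.
Qed.

Lemma Pol_affine k f : Pol k f -> Pol k (fun y => f (F y)).
Proof.
rewrite [X in _ -> Pol _ X](_ : _ = fun y =>
    f (e1.1 * y.1 + e2.1 * y.2 + (T 0).1, e1.2 * y.1 + e2.2 * y.2 + (T 0).2)); last first.
  by apply/funext => y; rewrite affine_mapE.
by apply: Pol_comp; apply: PolD; (try exact: Pol_cst); apply: PolD;
  apply: PolZ; (try exact: Pol_fst); exact: Pol_snd.
Qed.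

Lemma Pol_affine_inv k f : Pol k (fun y => f (F y)) -> Pol k f.
Proof.
move=> fP; have -> : f = fun x => f (F (affine_inv x)).
  by apply/funext => x; rewrite affine_invK.
have pP (a b c : R) : Pol 1 (fun x : R * R => a * x.1 + b * x.2 + c).
  by apply: PolD; (try exact: Pol_cst); apply: PolD;
    apply: PolZ; (try exact: Pol_fst); exact: Pol_snd.
apply: (@Pol_comp _ _ (fun y => f (F y))) fP.
- have := pP (e2.2 / D) (- e2.1 / D) (((T 0).2 * e2.1 - (T 0).1 * e2.2) / D).
  by congr Pol; apply/funext => x; rewrite /cross /=; ring.
- have := pP (- e1.2 / D) (e1.1 / D) (((T 0).1 * e1.2 - (T 0).2 * e1.1) / D).
  by congr Pol; apply/funext => x; rewrite /cross /=; ring.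
Qed.

(** A polynomial of degree one is determined by its values at the vertices. *)
Lemma nodal_basis_affine phi j y : nodal_basis T phi -> phi j (F y) = bary y j.
Proof.
move=> /(_ j) [phiP phiT].
have aff f : Pol 1 f -> f (F y) = \sum_i bary y i * f (T i).
  elim/Pol_ind => [|a f1 f2 _ _ -> ->|i k ik].
  - by rewrite big1// => i _; rewrite mulr0.
  - by rewrite !sum3E; ring.
  - rewrite affine_mapE sum3E /bary /=.
    by case: i k ik => [|[|]//] [|[|]//] _; ring.
rewrite (aff _ phiP) (bigD1 j)//= phiT eqxx mulr1 big1 ?addr0// => i /negPf ij.
by rewrite phiT eq_sym ij mulr0.
Qed.

Lemma measurable_tri_set : measurable (tri_set T : set plane).
Proof.
have -> : tri_set T = affine_inv @^-1` @simplex R.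
  by apply/seteqP; split => x /=; have [] := tri_set_affine (affine_inv x); rewrite affine_invK.
rewrite -[X in measurable X]setTI.
have mf : measurable_fun setT (affine_inv : plane -> plane).
  have D0 := affine_det_neq0.
  apply/measurable_fun_pairP; split.
  - have := measurable_affine_form (e2.2 / D) (- e2.1 / D) (((T 0).2 * e2.1 - (T 0).1 * e2.2) / D).
    by congr measurable_fun; apply/funext => x; rewrite /= /cross /=; ring.
  - have := measurable_affine_form (- e1.2 / D) (e1.1 / D) (((T 0).1 * e1.2 - (T 0).2 * e1.1) / D).
    by congr measurable_fun; apply/funext => x; rewrite /= /cross /=; ring.
by apply: mf => //; exact: measurable_simplex.
Qed.

(** The factor in the change of variables is found by integrating the constant
    function one: the reference simplex has area 1/2. *)
Lemma tri_int_area : 0 < area T /\ forall k f, Pol k f ->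
  tri_int T f = 2 * area T * simplex_int (fun y => f (F y)).
Proof.
have [|c Hc] := @scales_area_affine R e1.1 e2.1 e1.2 e2.2 (T 0).1 (T 0).2.
  by have := affine_det_neq0; rewrite /affine_det /cross [_ * e2.1]mulrC.
have {}Hc : scales_area c (F : plane -> plane).
  by congr scales_area: Hc; apply/funext => y; rewrite affine_mapE.
have [_ c0 _] := Hc.
have pullback k f : Pol k f -> tri_int T f = c^-1 * simplex_int (fun y => f (F y)).
  move=> fP; rewrite /simplex_int.
  have <- : F @^-1` tri_set T = @simplex R.
    by apply/seteqP; split => y /=; have [] := tri_set_affine y.
  rewrite (Rintegral_scales_area Hc measurable_tri_set (Pol_measurable fP)).
  by rewrite mulKf// gt_eqF.
have areaE : area T = c^-1 / 2.
  have := pullback 0 _ (Pol_cst 0 1).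
  rewrite /tri_int Rintegral_cst; last exact: measurable_tri_set.
  rewrite mul1r -/(area T) => ->; congr (_ * _).
  transitivity (moment R 0 0); last by rewrite /moment /= fact0 mul1r.
  rewrite -simplex_int_monomial; congr simplex_int.
  by apply/funext => y; rewrite !expr0 mulr1.
split; first by rewrite areaE divr_gt0 ?invr_gt0.
by move=> k f fP; rewrite areaE [2 * _]mulrC divfK// (pullback _ _ fP).
Qed.

Lemma area_gt0 : 0 < area T. Proof. by case: tri_int_area. Qed.

Lemma tri_int_affine k f : Pol k f ->
  tri_int T f = 2 * area T * simplex_int (fun y => f (F y)).
Proof. by case: tri_int_area => _; exact. Qed.

(** Rotate the edge vector d by a right angle, normalize, and choose the sign with
    the help of the cross product with a second edge, which is nonzero since the
    triangle is not degenerate. *)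
Lemma outer_unit_normal_exists j : exists n, outer_unit_normal T j n.
Proof.
have [k [l [kl X0]]] : exists k l, (forall i, i != j -> i = k \/ i = l) /\
    cross (T j - T k) (T k - T l) != 0.
  have := affine_det_neq0; rewrite /affine_det => D0.
  have other (a b c : 'I_3) : (forall i, [\/ i = a, i = b | i = c]) ->
      forall i, i != a -> i = b \/ i = c.
    by move=> abc i; have [->|->|->] := abc i; rewrite ?eqxx//; auto.
  have [->|->|->] := ord3P j.
  - exists 1, 2; split; first by apply: other => i; exact: ord3P.
    by apply: contra_neq D0 => <-; rewrite /cross /=; ring.
  - exists 2, 0; split; first by apply: other => i; case: (ord3P i); [exact: Or33|exact: Or31|exact: Or32].
    by apply: contra_neq D0 => <-; rewrite /cross /=; ring.
  - exists 0, 1; split; first by apply: other => i; case: (ord3P i); [exact: Or32|exact: Or33|exact: Or31].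
    by apply: contra_neq D0 => <-; rewrite /cross /=; ring.
pose d := T k - T l; pose X := cross (T j - T k) d.
have dd0 : 0 < dot d d.
  rewrite lt_def /dot addr_ge0 ?sqr_ge0// andbT.
  apply: contra_neq X0; rewrite -/d /cross => /eqP.
  rewrite paddr_eq0 ?sqr_ge0// -!expr2 !sqrf_eq0 => /andP[/eqP-> /eqP->].
  by rewrite !mulr0 subrr.
have N0 : 0 < Num.sqrt (dot d d) by rewrite sqrtr_gt0.
pose c := - Num.sg X / Num.sqrt (dot d d).
have cX : c * X < 0.
  by rewrite /c mulrAC mulNr -normrEsg mulNr oppr_lt0 divr_gt0// normr_gt0.
have nd (u : R * R) : dot (c * d.2, - (c * d.1)) u = c * cross u d.
  by rewrite /dot /cross /=; ring.
have ndd : dot (c * d.2, - (c * d.1)) d = 0 by rewrite nd /cross [d.2 * _]mulrC subrr mulr0.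
exists (c * d.2, - (c * d.1)); split.
- transitivity (c ^+ 2 * dot d d); first by rewrite /dot /=; ring.
  rewrite /c expr_div_n sqrrN sqr_sg X0 sqr_sqrtr ?(ltW dd0)//.
  by rewrite mul1r mulVf ?gt_eqF.
- move=> i i' /kl[]-> /kl[]->; rewrite ?subrr /dot ?mulr0 ?addr0//.
  by rewrite -opprB; move: ndd; rewrite /dot /d /=; lra.
- move=> i /kl[]->; first by rewrite nd.
  by move: cX ndd; rewrite -(nd (T j - T k)) /dot /d /=; lra.
Qed.

(** A vanishing normal component means being parallel to the edge.  This form of
    the boundary condition is the one that the chart respects. *)
Lemma RTint_tangential m v j k l x : RTint m T v -> edge T j x ->
  k != j -> l != j -> cross (v x) (T k - T l) = 0.
Proof.
move=> [_ vn] xj kj lj; have [n nP] := outer_unit_normal_exists j.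
have := vn _ _ _ nP xj; have [n1 /(_ k l kj lj) nd _] := nP => vn0.
have : dot n n * cross (v x) (T k - T l) =
    dot (v x) n * cross n (T k - T l) - cross n (v x) * dot n (T k - T l).
  by rewrite /dot /cross; ring.
by rewrite n1 nd vn0 mul1r mul0r mulr0 subr0.
Qed.

(** The inverse Piola transform of v: by Cramer's rule this is
    det DF times DF^-1 applied to v (F y). *)
Definition pullback v y : R * R := (cross (v (F y)) e2, cross e1 (v (F y))).

Lemma affine_map_line y w t : F (y + t *: w) = F y + t *: affine_lin T w.
Proof.
rewrite !affine_mapE /affine_lin [RHS]surjective_pairing /= !scaleRE.
by congr pair; ring.
Qed.

Lemma derive_affine k f y w : Pol k f ->
  'D_w (fun y => f (F y)) y = 'D_(affine_lin T w) f (F y).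
Proof.
move=> fP; have [p pE] := Pol_line (F y) (affine_lin T w) fP.
rewrite (derive_line pE); apply: derive_line => t.
by rewrite affine_map_line.
Qed.

Definition polyfield k (v : R * R -> R * R) :=
  Pol k (fun x => (v x).1) /\ Pol k (fun x => (v x).2).

(** Chain rule: the mixed terms cancel and the determinant of the chart remains. *)
Lemma divergence_pullback k v y : polyfield k v ->
  divergence (pullback v) y = D * divergence v (F y).
Proof.
move=> [v1P v2P].
have dE a b w : 'D_w (fun y => a * (v (F y)).1 + b * (v (F y)).2) y =
    a * ((affine_lin T w).1 * 'D_(1, 0) (fun x => (v x).1) (F y) +
         (affine_lin T w).2 * 'D_(0, 1) (fun x => (v x).1) (F y)) +
    b * ((affine_lin T w).1 * 'D_(1, 0) (fun x => (v x).2) (F y) +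
         (affine_lin T w).2 * 'D_(0, 1) (fun x => (v x).2) (F y)).
  have wE (u : R * R) : u = u.1 *: (1, 0) + u.2 *: (0, 1).
    by rewrite [LHS]surjective_pairing; congr pair;
      rewrite /= scaler0 ?addr0 ?add0r [_%:A]mulr1.
  have [u1P u2P] := (Pol_affine v1P, Pol_affine v2P).
  rewrite (derive_lin _ _ _ (PolZ a u1P) u2P).
  have := derive_lin a y w (Pol0 R k) u1P.
  rewrite derive_cst add0r.
  under eq_fun do rewrite add0r.
  move=> ->; rewrite (derive_affine _ _ v1P) (derive_affine _ _ v2P).
  have := derive_dir (F y) (affine_lin T w).1 (affine_lin T w).2 (1, 0) (0, 1) v1P.
  have := derive_dir (F y) (affine_lin T w).1 (affine_lin T w).2 (1, 0) (0, 1) v2P.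
  by rewrite -!wE => -> ->.
rewrite {1}/divergence /pullback /=.
rewrite (_ : (fun y => cross (v (F y)) e2) =
  fun y => e2.2 * (v (F y)).1 + (- e2.1) * (v (F y)).2); last first.
  by apply/funext => z; rewrite /cross; ring.
rewrite (_ : (fun y => cross e1 (v (F y))) =
  fun y => (- e1.2) * (v (F y)).1 + e1.1 * (v (F y)).2); last first.
  by apply/funext => z; rewrite /cross; ring.
rewrite !dE /affine_lin /= !scale1r !scale0r !addr0 !add0r.
rewrite /divergence /affine_det /cross /=.
do 4 move: (derive _ _ _) => ?.
by ring.
Qed.

Lemma RT_polyfield m v : RT m v -> polyfield m.+1 v.
Proof.
move=> [p1 [p2 [q [p1P p2P qP vE]]]]; split; rewrite -[m.+1]addn1.
- rewrite (_ : (fun x => _) = fun x => p1 x + q x * x.1).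
    apply: PolD; first by apply: Pol_leq p1P; rewrite leq_addr.
    by apply: PolM => //; exact: Pol_fst.
  by apply/funext => x; rewrite vE.
- rewrite (_ : (fun x => _) = fun x => p2 x + q x * x.2).
    apply: PolD; first by apply: Pol_leq p2P; rewrite leq_addr.
    by apply: PolM => //; exact: Pol_snd.
  by apply/funext => x; rewrite vE.
Qed.

Lemma polyfield_divergence k v : polyfield k.+1 v -> Pol k (divergence v).
Proof. by move=> [v1P v2P]; apply: PolD; exact: Pol_derive. Qed.

Lemma pullback_polyfield k v : polyfield k v -> polyfield k (pullback v).
Proof.
move=> [/Pol_affine v1P /Pol_affine v2P]; split; rewrite /pullback /cross /=.
- have := PolD (PolZ e2.2 v1P) (PolZ (- e2.1) v2P).
  by congr Pol; apply/funext => y; ring.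
- have := PolD (PolZ (- e1.2) v1P) (PolZ e1.1 v2P).
  by congr Pol; apply/funext => y; ring.
Qed.

(** The edges opposite to the second, third and first vertex are the images of the
    vertical leg, the horizontal leg and the hypotenuse. *)
Lemma RTint_pullback m v : RTint m T v -> forall t, 0 <= t <= 1 ->
  [/\ (pullback v (0, t)).1 = 0, (pullback v (t, 0)).2 = 0 &
      (pullback v (1 - t, t)).1 + (pullback v (1 - t, t)).2 = 0].
Proof.
move=> vRT t /andP[t0 t1].
have tang y j k l : simplex y -> bary y j = 0 -> k != j -> l != j ->
    cross (v (F y)) (T k - T l) = 0.
  by move=> yS yj; apply: (RTint_tangential vRT); exact: edge_affine.
split; rewrite /pullback /=.
- by apply: (tang _ 1) => //; split => //=; lra.
- have : cross (v (F (t, 0))) e1 = 0 by apply: (tang _ 2) => //; split => //=; lra.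
  by rewrite /cross; lra.
- have : cross (v (F (1 - t, t))) (T 2 - T 1) = 0.
    apply: (tang _ 0) => //; last by rewrite /bary /=; lra.
    by split => /=; lra.
  by rewrite /cross /=; lra.
Qed.

(** The divergence theorem on T, pulled back to the reference simplex. *)
Lemma tri_int_divergence m v : RTint m T v -> tri_int T (divergence v) = 0.
Proof.
move=> vRT; have vP := RT_polyfield vRT.1.
rewrite (tri_int_affine (polyfield_divergence vP)).
have [p1P p2P] := pullback_polyfield vP.
have := simplex_int_divergence_tangential p1P p2P.
move=> /(_ (fun t t01 => let: And3 h _ _ := RTint_pullback vRT t01 in h)).
move=> /(_ (fun t t01 => let: And3 _ h _ := RTint_pullback vRT t01 in h)).
move=> /(_ (fun t t01 => let: And3 _ _ h := RTint_pullback vRT t01 in h)).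
rewrite (_ : (fun y => _) = fun y => D * divergence v (F y)); last first.
  by apply/funext => y; rewrite -(divergence_pullback _ vP).
rewrite (simplex_intZ _ (Pol_affine (polyfield_divergence vP))).
by move=> /eqP; rewrite mulf_eq0 (negPf affine_det_neq0) /= => /eqP->; rewrite mulr0.
Qed.

End Triangles.

(** * Divergences of the basis functions in the chart *)
Section SparsePolynomials.
Variable R : realType.
Implicit Types (f g : R * R -> R) (x y : R * R) (s : seq (R * (nat * nat))).

(** Polynomials given by a list of pairs (coefficient, (i, j)), so that degrees,
    products with monomials and moments can be computed. *)
Definition spoly s x : R := \sum_(m <- s) m.1 * (x.1 ^+ m.2.1 * x.2 ^+ m.2.2).

Lemma spoly_nil x : spoly [::] x = 0.
Proof. exact: big_nil. Qed.

Lemma spoly_cons m s x :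
  spoly (m :: s) x = m.1 * (x.1 ^+ m.2.1 * x.2 ^+ m.2.2) + spoly s x.
Proof. exact: big_cons. Qed.

Definition spolyE := (spoly_cons, spoly_nil).

Lemma Pol_spoly k s : all (fun m => (m.2.1 + m.2.2 <= k)%N) s -> Pol k (spoly s).
Proof.
elim: s => [_|m s IH /= /andP[mk /IH sP]].
  by have := Pol0 R k; congr Pol; apply/funext => x; rewrite spoly_nil.
have := PolD (PolZ m.1 (Pol_monomial R mk)) sP.
by congr Pol; apply/funext => x; rewrite spoly_cons.
Qed.

Definition spoly_shift a b s := [seq (m.1, (m.2.1 + a, m.2.2 + b)%N) | m <- s].

Lemma spoly_shiftE a b s x :
  spoly (spoly_shift a b s) x = spoly s x * (x.1 ^+ a * x.2 ^+ b).
Proof.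
elim: s => [|m s IH]; first by rewrite !spoly_nil mul0r.
by rewrite /= !spoly_cons IH mulrDl /= !exprD; ring.
Qed.

Fixpoint smoment s : R :=
  if s is m :: s' then m.1 * moment R m.2.1 m.2.2 + smoment s' else 0.

Lemma simplex_int_spoly s : simplex_int (spoly s) = smoment s.
Proof.
suff [k [_ sE]] : exists k, Pol k (spoly s) /\ simplex_int (spoly s) = smoment s by [].
have nilE : spoly [::] = fun=> 0 by apply/funext => x; exact: spoly_nil.
elim: s => [|m s [k [sP IH]]] /=.
  by exists 0; rewrite nilE simplex_int0; split => //; exact: Pol0.
have consE : spoly (m :: s) = fun x => m.1 * (x.1 ^+ m.2.1 * x.2 ^+ m.2.2) + spoly s x.
  by apply/funext => x; rewrite spoly_cons.
pose l := maxn (m.2.1 + m.2.2) k.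
have mP : Pol l (fun x : R * R => x.1 ^+ m.2.1 * x.2 ^+ m.2.2).
  by apply: Pol_monomial; exact: leq_maxl.
have {}sP : Pol l (spoly s) by apply: Pol_leq sP; exact: leq_maxr.
exists l; rewrite consE; split; first exact: PolD (PolZ _ mP) sP.
by rewrite (simplex_intD (PolZ _ mP) sP) (simplex_intZ _ mP) simplex_int_monomial IH.
Qed.

Lemma Pol_split k f : Pol k.+1 f -> exists (a : nat -> R) (l : R * R -> R),
  Pol k l /\ forall x, f x = l x + \sum_(i < k.+2) a i * (x.1 ^+ i * x.2 ^+ (k.+1 - i)).
Proof.
elim/Pol_ind => [|c f1 f2 _ _ [a1 [l1 [l1P f1E]]] [a2 [l2 [l2P f2E]]]|i j ijk].
- exists (fun=> 0), (fun=> 0); split; first exact: Pol0.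
  by move=> x; rewrite big1 ?addr0// => i _; rewrite mul0r.
- exists (fun i => a1 i + c * a2 i), (fun x => l1 x + c * l2 x).
  split; first exact: Pol_lin.
  move=> x; rewrite f1E f2E mulrDr addrACA mulr_sumr -big_split /=; congr (_ + _).
  by apply: eq_bigr => i _; rewrite mulrDl -[c * _ * _]mulrA.
move: ijk; rewrite leq_eqVlt ltnS => /predU1P[ijk|ijk].
  exists (fun i' => (i' == i)%:R), (fun=> 0); split; first exact: Pol0.
  have ik : (i < k.+2)%N by rewrite ltnS -ijk leq_addr.
  move=> x; rewrite (bigD1 (Ordinal ik))//= eqxx mul1r add0r.
  rewrite big1 ?addr0 => [|i' /negPf ii'].
    by rewrite (_ : (k.+1 - i)%N = j)// -ijk addKn.
  by rewrite (_ : (i' == i :> nat) = false) ?mul0r// -ii'.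
exists (fun=> 0), (fun x => x.1 ^+ i * x.2 ^+ j); split; first exact: Pol_monomial.
by move=> x; rewrite big1 ?addr0// => i' _; rewrite mul0r.
Qed.

Lemma Pol0_cst f : Pol 0 f -> exists a, forall x, f x = a.
Proof.
elim/Pol_ind => [|c f1 f2 _ _ [a1 f1E] [a2 f2E]|[|//] [|//] _].
- by exists 0.
- by exists (a1 + c * a2) => x; rewrite f1E f2E.
- by exists 1 => x; rewrite !expr0 mulr1.
Qed.

Lemma Pol1_spoly f : Pol 1 f -> exists a b c : R,
  f = spoly [:: (a, (0, 0)); (b, (1, 0)); (c, (0, 1))]%N.
Proof.
move=> /Pol_split[a [l [/Pol0_cst[c lE] fE]]].
exists c, (a 1), (a 0); apply/funext => x.
by rewrite fE lE !big_ord_recl big_ord0 !spolyE /= /bump /=; ring.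
Qed.

Lemma Pol1E f : Pol 1 f -> exists a b c : R, forall y, f y = a + b * y.1 + c * y.2.
Proof.
move=> /Pol1_spoly[a [b [c ->]]]; exists a, b, c => y.
by rewrite !spolyE /=; ring.
Qed.

Lemma Pol2_spoly f : Pol 2 f -> exists a b c d e h : R, f =
  spoly [:: (a, (0, 0)); (b, (1, 0)); (c, (0, 1));
            (d, (2, 0)); (e, (1, 1)); (h, (0, 2))]%N.
Proof.
move=> /Pol_split[a [l [/Pol1_spoly[c0 [c1 [c2 ->]]] fE]]].
exists c0, c1, c2, (a 2), (a 1), (a 0); apply/funext => x.
by rewrite fE !big_ord_recl big_ord0 !spolyE /= /bump /=; ring.
Qed.

Lemma moment_table :
  ((moment R 0 0 = 1/2) * (moment R 1 0 = 1/6) * (moment R 0 1 = 1/6) *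
  (moment R 2 0 = 1/12) * (moment R 1 1 = 1/24) * (moment R 0 2 = 1/12) *
  (moment R 3 0 = 1/20) * (moment R 2 1 = 1/60) * (moment R 1 2 = 1/60) *
  (moment R 0 3 = 1/20) *
  (moment R 4 0 = 1/30) * (moment R 3 1 = 1/120) * (moment R 2 2 = 1/180) *
  (moment R 1 3 = 1/120) * (moment R 0 4 = 1/30) *
  (moment R 5 0 = 1/42) * (moment R 4 1 = 1/210) * (moment R 3 2 = 1/420) *
  (moment R 2 3 = 1/420) * (moment R 1 4 = 1/210) * (moment R 0 5 = 1/42))%type.
Proof.
have m i j : moment R i j = (i`! * j`!)%:R / (i + j + 2)`!%:R by [].
do !split; rewrite m ?addnS ?addn0 ?add0n !factS !fact0 !natrM; by field.
Qed.

(** Integrating r against all monomials of degree at most k gives a linear system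
    for the coefficients of r, whose matrix, the Gram matrix of the monomials, is
    invertible. *)
Lemma Pol_orthogonal_self k r : (k <= 2)%N -> Pol k r ->
  (forall g, Pol k g -> simplex_int (fun y => r y * g y) = 0) ->
  forall y, r y = 0.
Proof.
move=> k2 + orth.
have mom i j s : (i + j <= k)%N -> r = spoly s -> smoment (spoly_shift i j s) = 0.
  move=> ijk rE; have := orth _ (Pol_monomial R ijk); rewrite -simplex_int_spoly.
  by move=> <-; congr simplex_int; apply/funext => y; rewrite spoly_shiftE rE.
case: k k2 orth mom => [|[|[|//]]] _ _ mom.
- move=> /Pol0_cst[a rE] y; rewrite rE.
  have := mom 0 0 [:: (a, (0, 0))]%N isT.
  rewrite /= !moment_table => H.
  suff : a * (1 / 2) + 0 = 0 by lra.
  by apply: H; apply/funext => z; rewrite rE !spolyE /=; ring.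
- move=> /Pol1_spoly[a [b [c rE]]] y.
  have /= := mom 0 0 _ isT rE; have /= := mom 1 0 _ isT rE.
  have /= := mom 0 1 _ isT rE; rewrite rE !spolyE /= !moment_table => *.
  have [-> [-> ->]] : a = 0 /\ b = 0 /\ c = 0 by lra.
  by ring.
move=> /Pol2_spoly[a [b [c [d [e [h rE]]]]]] y.
have /= := mom 0 0 _ isT rE; have /= := mom 1 0 _ isT rE.
have /= := mom 0 1 _ isT rE; have /= := mom 2 0 _ isT rE.
have /= := mom 1 1 _ isT rE; have /= := mom 0 2 _ isT rE.
rewrite rE !spolyE /= !moment_table => *.
have [a0 b0 c0] : [/\ a = 0, b = 0 & c = 0] by split; lra.
have [d0 e0 h0] : [/\ d = 0, e = 0 & h = 0] by split; lra.
by rewrite a0 b0 c0 d0 e0 h0; ring.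
Qed.

(** With t the barycentric coordinate number j, the entries of the lists below are
    the expansions of 3 t - 1, 20 t^2 - 16 t + 2 and
    (35 t^3 - 45 t^2 + 15 t - 1) / 7; the last entry of divRT3 belongs to the fourth
    function.  In each list the monomials of top degree come first. *)
Definition divRT1 (j : 'I_3) : seq (R * (nat * nat)) := nth [::] [::
  [:: (-3, (1, 0)%N); (-3, (0, 1)%N); (2, (0, 0)%N)];
  [:: (3, (1, 0)%N); (-1, (0, 0)%N)];
  [:: (3, (0, 1)%N); (-1, (0, 0)%N)]] j.

Definition divRT2 (j : 'I_3) : seq (R * (nat * nat)) := nth [::] [::
  [:: (20, (2, 0)%N); (40, (1, 1)%N); (20, (0, 2)%N); (-24, (1, 0)%N); (-24, (0, 1)%N); (6, (0, 0)%N)];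
  [:: (20, (2, 0)%N); (-16, (1, 0)%N); (2, (0, 0)%N)];
  [:: (20, (0, 2)%N); (-16, (0, 1)%N); (2, (0, 0)%N)]] j.

Definition divRT3 (j : 'I_4) : seq (R * (nat * nat)) := nth [::] [::
  [:: (-5, (3, 0)%N); (-15, (2, 1)%N); (-15, (1, 2)%N); (-5, (0, 3)%N);
      (60/7, (2, 0)%N); (120/7, (1, 1)%N); (60/7, (0, 2)%N);
      (-30/7, (1, 0)%N); (-30/7, (0, 1)%N); (4/7, (0, 0)%N)];
  [:: (5, (3, 0)%N); (-45/7, (2, 0)%N); (15/7, (1, 0)%N); (-1/7, (0, 0)%N)];
  [:: (5, (0, 3)%N); (-45/7, (0, 2)%N); (15/7, (0, 1)%N); (-1/7, (0, 0)%N)];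
  [:: (-10, (2, 1)%N); (40/7, (1, 1)%N); (10/7, (2, 0)%N); (-20/21, (1, 0)%N);
      (-10/21, (0, 1)%N); (2/21, (0, 0)%N)]] j.

Lemma spoly_orthogonal k s :
  (forall i j, (i + j <= k)%N -> smoment (spoly_shift i j s) = 0) ->
  forall g, Pol k g -> simplex_int (fun y => spoly s y * g y) = 0.
Proof.
move=> s0; have [l sP] : exists l, Pol l (spoly s).
  exists (\sum_(m <- s) (m.2.1 + m.2.2)); apply: Pol_spoly; apply/allP => m ms.
  by rewrite (big_rem m ms) leq_addr.
have gE g : Pol k g -> Pol (l + k) (fun y => spoly s y * g y) by exact: PolM.
move=> g; elim/Pol_ind => [|a f1 f2 f1P f2P i1 i2|i j ijk].
- by rewrite -[RHS](simplex_int0 R); congr simplex_int; apply/funext => y; rewrite mulr0.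
- rewrite -[RHS](addr0 0) -{1}i1 -(mulr0 a) -i2 -(simplex_int_lin a (gE _ f1P) (gE _ f2P)).
  by congr simplex_int; apply/funext => y; ring.
- rewrite -(s0 i j ijk) -simplex_int_spoly.
  by congr simplex_int; apply/funext => y; rewrite spoly_shiftE.
Qed.

Lemma divRT1_orthogonal j g : Pol 0 g ->
  simplex_int (fun y => spoly (divRT1 j) y * g y) = 0.
Proof.
apply: spoly_orthogonal => -[|//] [|//] _.
by case: j => [[|[|[|//]]] ?]; rewrite /divRT1 /= !moment_table; field.
Qed.

Lemma divRT2_orthogonal j g : Pol 1 g ->
  simplex_int (fun y => spoly (divRT2 j) y * g y) = 0.
Proof.
apply: spoly_orthogonal => -[|[|//]] [|[|//]] // _;
  case: j => [[|[|[|//]]] ?]; rewrite /divRT2 /= !moment_table; by field.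
Qed.

Lemma divRT3_orthogonal j g : Pol 2 g ->
  simplex_int (fun y => spoly (divRT3 j) y * g y) = 0.
Proof.
apply: spoly_orthogonal => -[|[|[|//]]] [|[|[|//]]] // _;
  case: j => [[|[|[|[|//]]]] ?]; rewrite /divRT3 /= !moment_table; by field.
Qed.

End SparsePolynomials.

Section Reference.
Variable R : realType.
Notation divRT1 := (@divRT1 R).
Notation divRT2 := (@divRT2 R).
Notation divRT3 := (@divRT3 R).

Notation widen23 := (widen_ord (isT : (2 <= 3)%N)).

Lemma divRT1_free (c : 'I_2 -> R) :
  (forall y, simplex y -> \sum_i c i * spoly (divRT1 (widen23 i)) y = 0) ->
  forall i, c i = 0.
Proof.
move=> c0; have /= : simplex ((0, 0) : R * R) by split => /=; lra.
move/c0; have /= : simplex ((1, 0) : R * R) by split => /=; lra.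
move/c0; rewrite !sum2E /divRT1 !spolyE /= ?(expr0, expr1n, expr0n) /= => e1 e2 i.
by case: (ord2P i) => ->; lra.
Qed.

Lemma divRT2_free (c : 'I_3 -> R) :
  (forall y, simplex y -> \sum_i c i * spoly (divRT2 i) y = 0) ->
  forall i, c i = 0.
Proof.
move=> c0; have /= : simplex ((0, 0) : R * R) by split => /=; lra.
move/c0; have /= : simplex ((1, 0) : R * R) by split => /=; lra.
move/c0; have /= : simplex ((0, 1) : R * R) by split => /=; lra.
move/c0; rewrite !sum3E /divRT2 !spolyE /= ?(expr0, expr1n, expr0n) /= => e1 e2 e3 i.
by case: (ord3P i) => ->; lra.
Qed.

(** Four values determine a combination.  The combination
    psi_4 - psi_1 / 3 - psi_2 + psi_3 / 3 has a divergence that vanishes at the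
    vertices, at the midpoints of the edges and at the barycentre; therefore the
    fourth point is (1/4, 0). *)
Lemma divRT3_free (c : 'I_4 -> R) :
  (forall y, simplex y -> \sum_i c i * spoly (divRT3 i) y = 0) ->
  forall i, c i = 0.
Proof.
move=> c0; have /= : simplex ((0, 0) : R * R) by split => /=; lra.
move/c0; have /= : simplex ((1, 0) : R * R) by split => /=; lra.
move/c0; have /= : simplex ((0, 1) : R * R) by split => /=; lra.
move/c0; have /= : simplex ((4^-1, 0) : R * R) by split => /=; lra.
move/c0; rewrite !sum4E /divRT3 !spolyE /= ?(expr0, expr1n, expr0n) /= => e1 e2 e3 e4 i.
by case: (ord4P i) => ->; lra.
Qed.

(** The coefficients c solve the triangular system which equates leading forms;
    dropping the leading monomials from the lists leaves the lower order part. *)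
Lemma divRT1_top q : Pol 1 q -> exists c : 'I_2 -> R,
  Pol 0 (fun y => q y - \sum_i c i * spoly (divRT1 (widen23 i)) y).
Proof.
move=> /Pol_split[a [l [lP qE]]].
pose c (i : 'I_2) := [:: - a 0%N / 3; (a 1%N - a 0%N) / 3]`_i.
pose low (i : 'I_2) := drop (nth 0 [:: 2; 1] i)%N (divRT1 (widen23 i)).
exists c; have lowP i : Pol 0 (spoly (low i)).
  by apply: Pol_spoly; case: (ord2P i) => ->.
have := PolB lP (Pol_sum (fun i => PolZ (c i) (lowP i))).
congr Pol; apply/funext => y.
rewrite qE !big_ord_recl !big_ord0 /c /low /= /bump /=.
rewrite /divRT1 /= !spolyE /=; by field.
Qed.

Lemma divRT2_top q : Pol 2 q -> exists c : 'I_3 -> R,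
  Pol 1 (fun y => q y - \sum_i c i * spoly (divRT2 i) y).
Proof.
move=> /Pol_split[a [l [lP qE]]].
pose c (i : 'I_3) := [:: a 1%N / 40; a 2%N / 20 - a 1%N / 40; a 0%N / 20 - a 1%N / 40]`_i.
pose low (i : 'I_3) := drop (nth 0 [:: 3; 1; 1] i)%N (divRT2 i).
exists c; have lowP i : Pol 1 (spoly (low i)).
  by apply: Pol_spoly; case: (ord3P i) => ->.
have := PolB lP (Pol_sum (fun i => PolZ (c i) (lowP i))).
congr Pol; apply/funext => y.
rewrite qE !big_ord_recl !big_ord0 /c /low /= /bump /=.
rewrite /divRT2 /= !spolyE /=; by field.
Qed.

Lemma divRT3_top q : Pol 3 q -> exists c : 'I_4 -> R,
  Pol 2 (fun y => q y - \sum_i c i * spoly (divRT3 i) y).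
Proof.
move=> /Pol_split[a [l [lP qE]]].
pose c (i : 'I_4) := [:: - a 1%N / 15; a 3%N / 5 - a 1%N / 15; a 0%N / 5 - a 1%N / 15;
                         (a 1%N - a 2%N) / 10]`_i.
pose low (i : 'I_4) := drop (nth 0 [:: 4; 1; 1; 1] i)%N (divRT3 i).
exists c; have lowP i : Pol 2 (spoly (low i)).
  by apply: Pol_spoly; case: (ord4P i) => ->.
have := PolB lP (Pol_sum (fun i => PolZ (c i) (lowP i))).
congr Pol; apply/funext => y.
rewrite qE !big_ord_recl !big_ord0 /c /low /= /bump /=.
rewrite /divRT3 /= !spolyE /=; by field.
Qed.

End Reference.

(** * Polynomial and tangential vector fields *)
Section Fields.
Variable R : realType.
Implicit Types (f g : R * R -> R) (x y : R * R) (u v : R * R -> R * R).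

Lemma polyfield_lin k a u v : polyfield k u -> polyfield k v ->
  polyfield k (a *: u + v).
Proof.
move=> [u1 u2] [v1 v2]; split.
- exact: (PolD (PolZ a u1) v1).
- exact: (PolD (PolZ a u2) v2).
Qed.

Lemma polyfield0 k : polyfield k (0 : R * R -> R * R).
Proof. by split; exact: Pol0. Qed.

Lemma divergence_lin k a u v x : polyfield k u -> polyfield k v ->
  divergence (a *: u + v) x = a * divergence u x + divergence v x.
Proof.
move=> [u1 u2] [v1 v2].
have lin f g w : Pol k f -> Pol k g ->
    'D_w (fun y => a * f y + g y) x = a * 'D_w f x + 'D_w g x.
  move=> fP gP; rewrite [RHS]addrC -(derive_lin a x w gP fP).
  by congr derive; apply/funext => y; rewrite addrC.
rewrite /divergence; rewrite (lin _ _ _ u1 v1) (lin _ _ _ u2 v2); ring.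
Qed.

Lemma divergence0 x : divergence (0 : R * R -> R * R) x = 0.
Proof. by rewrite /divergence !derive_cst addr0. Qed.

Lemma polyfield_sum k n (c : 'I_n -> R) (f : 'I_n -> R * R -> R * R) :
  (forall i, polyfield k (f i)) -> polyfield k (\sum_i c i *: f i).
Proof.
move=> fP; elim/big_rec: _ => [|i v _ vP]; first exact: polyfield0.
exact: polyfield_lin.
Qed.

Lemma divergence_sum k n (c : 'I_n -> R) (f : 'I_n -> R * R -> R * R) x :
  (forall i, polyfield k (f i)) ->
  divergence (\sum_i c i *: f i) x = \sum_i c i * divergence (f i) x.
Proof.
move=> fP; suff [] : polyfield k (\sum_i c i *: f i) /\
    divergence (\sum_i c i *: f i) x = \sum_i c i * divergence (f i) x by [].
elim/big_rec2: _ => [|i v d _ [vP <-]].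
  by split; [exact: polyfield0|exact: divergence0].
by rewrite (divergence_lin _ _ (fP i) vP); split => //; exact: polyfield_lin.
Qed.

(** The product rule, with div (x - P) = 2. *)
Lemma divergence_radial k f P x : Pol k f ->
  divergence (fun x => f x *: (x - P)) x = 2 * f x + 'D_(x - P) f x.
Proof.
move=> fP.
have prod w b g : Pol 1 g -> (forall t, g (x + t *: w) = g x + t * b) ->
    'D_w (fun y => f y * g y) x = 'D_w f x * g x + f x * b.
  move=> gP gb; have [p pE] := Pol_line x w fP.
  rewrite (derive_line pE) (@derive_line _ _ _ _ (p * ((g x)%:P + b *: 'X))).
    have := pE 0; rewrite scale0r addr0 => ->.
    rewrite derivM derivD derivC derivZ derivX add0r !hornerE /=; ring.
  by move=> t; rewrite pE gb !hornerE; ring.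
rewrite {1}/divergence /=.
rewrite (prod (1, 0) 1 (fun y => y.1 - P.1)); last 2 first.
- by apply: PolB; [exact: Pol_fst|exact: Pol_cst].
- by move=> t; rewrite /= !scaleRE; ring.
rewrite (prod (0, 1) 1 (fun y => y.2 - P.2)); last 2 first.
- by apply: PolB; [exact: Pol_snd|exact: Pol_cst].
- by move=> t; rewrite /= !scaleRE; ring.
have -> : x - P = (x.1 - P.1) *: (1, 0) + (x.2 - P.2) *: (0, 1) :> R * R.
  by rewrite [LHS]surjective_pairing; congr pair; rewrite /= !scaleRE; ring.
rewrite (derive_dir _ _ _ _ _ fP); ring.
Qed.

Lemma RT_lin m a u v : RT m u -> RT m v -> RT m (a *: u + v).
Proof.
move=> [p1 [p2 [q [p1P p2P qP uE]]]] [p1' [p2' [q' [p1P' p2P' qP' vE]]]].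
exists (fun x => a * p1 x + p1' x), (fun x => a * p2 x + p2' x),
  (fun x => a * q x + q' x); split; try exact: (PolD (PolZ a _)).
move=> x; rewrite [LHS]surjective_pairing /= uE vE /= !scaleRE.
by congr pair; rewrite /= ?scaleRE; ring.
Qed.

Variable T : triangle R.

Lemma RTint_lin m a u v : RTint m T u -> RTint m T v -> RTint m T (a *: u + v).
Proof.
move=> [uR un] [vR vn]; split; first exact: RT_lin.
move=> j n x nP xj; have := un j n x nP xj; have := vn j n x nP xj.
rewrite /dot /=;
rewrite !scaleRE => v0 u0; transitivity (a * 0 + 0 : R); last by ring.
by rewrite -{1}u0 -v0; ring.
Qed.

Lemma RTint0 m : RTint m T 0.
Proof.
split.
  exists (fun=> 0), (fun=> 0), (fun=> 0); split; try exact: Pol0.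
  by move=> x; rewrite scale0r addr0.
by move=> j n x _ _; rewrite /dot /= !mul0r addr0.
Qed.

Lemma RTint_sum m n (c : 'I_n -> R) (f : 'I_n -> R * R -> R * R) :
  (forall i, RTint m T (f i)) -> RTint m T (\sum_i c i *: f i).
Proof.
move=> fP; elim/big_rec: _ => [|i v _ vP]; first exact: RTint0.
exact: RTint_lin.
Qed.

Lemma edgeP j x : edge T j x -> exists2 y, x = affine_map T y & bary y j = 0.
Proof.
move=> [t [t0 t1 tj ->]]; rewrite sum3E in t1.
have tE i : t i = bary (t 1, t 2) i.
  by case: (ord3P i) => ->; rewrite /bary //= -t1; ring.
exists (t 1, t 2); last by rewrite -tE.
by rewrite affine_map_bary; apply: eq_bigr => i _; rewrite -tE.
Qed.

(** On the edge j the factor f vanishes; on the other two edges, which contain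
    the vertex T j, the vector x - T j is parallel to the edge. *)
Lemma RTint_radial m f j : Pol m f -> (forall x, edge T j x -> f x = 0) ->
  RTint m T (fun x => f x *: (x - T j)).
Proof.
move=> fP f0;
split.
  exists (fun x => - (T j).1 * f x), (fun x => - (T j).2 * f x), f.
  split => //; try exact: PolZ.
  move=> x; rewrite [LHS]surjective_pairing /= !scaleRE.
  by congr pair; rewrite /= ?scaleRE; ring.
move=> i n x [_ nT _] xi; have [ij|ij] := eqVneq i j.
  by rewrite f0 -?ij// scale0r /dot /= !mul0r addr0.
suff n0 : dot n (x - T j) = 0.
  transitivity (f x * dot n (x - T j)); last by rewrite n0 mulr0.
  by rewrite /dot /= !scaleRE; ring.
have [y -> yi] := edgeP xi.
transitivity (\sum_k bary y k * dot n (T k - T j)).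
  rewrite affine_map_bary sum3E sum3E /dot /bary /= !scaleRE; ring.
rewrite big1// => k _; have [->|ki] := eqVneq k i; first by rewrite yi mul0r.
by rewrite nT ?mulr0// eq_sym.
Qed.

End Fields.

Lemma RTint_leq (R : realType) (T : triangle R) k m v : (k <= m)%N ->
  RTint k T v -> RTint m T v.
Proof.
move=> km [[p1 [p2 [q [p1P p2P qP vE]]]] vn]; split => //.
by exists p1, p2, q; split => //; exact: Pol_leq km _.
Qed.

(** * The basis functions on a triangle *)
Section Basis.
Variables (R : realType) (T : triangle R) (phi : 'I_3 -> R * R -> R).
Hypothesis phiT : nodal_basis T phi.
Implicit Types (f g : R * R -> R) (x y : R * R) (u v : R * R -> R * R).
Notation F := (affine_map T).
Notation s := (2 * area T)^-1.

Lemma phi_affine j y : phi j (F y) = bary y j.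
Proof. exact: nodal_basis_affine. Qed.

Lemma phi_Pol j : Pol 1 (phi j).
Proof. by case: (phiT j). Qed.

Lemma phi_edge j x : edge T j x -> phi j x = 0.
Proof. by move=> /edgeP[y -> yj]; rewrite phi_affine. Qed.

(** The nodal function is affine on lines, and its value at T j is known. *)
Lemma phi_line i j x t :
  phi i (x + t *: (x - T j)) = phi i x + t * (phi i x - (i == j)%:R).
Proof.
have [fP fT] := phiT i; rewrite -(fT j).
elim/Pol_ind: {fT} fP => [|a f1 f2 _ _ -> ->|].
- by ring.
- by ring.
case=> [|[|//]] [|[|//]] //= _; rewrite !(expr0, expr1) /= ?scaleRE; ring.
Qed.

Lemma Pol_horner (g : {poly R}) f : Pol 1 f -> Pol (size g) (fun x => g.[f x]).
Proof.
move=> fP; have iP (i : 'I_(size g)) : Pol (size g) (fun x => g`_i * f x ^+ i).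
  by apply/PolZ/(Pol_leq _ (PolX i fP)); rewrite muln1 ltnW.
have := Pol_sum iP.
by congr Pol; apply/funext => x; rewrite horner_coef.
Qed.

(** On the line through x and T j the nodal function phi_j is
    phi_j x + t (phi_j x - 1), and g is composed with this affine function. *)
Lemma divergence_barycentric (g : {poly R}) j x :
  divergence (fun x => g.[phi j x] *: (x - T j)) x =
  2 * g.[phi j x] + g^`().[phi j x] * (phi j x - 1).
Proof.
rewrite (divergence_radial _ _ (Pol_horner g (phi_Pol j))); congr (_ + _).
rewrite (@derive_line _ _ _ _ (g \Po ((phi j x)%:P + (phi j x - 1) *: 'X))).
  by rewrite deriv_comp derivD derivC derivZ derivX add0r hornerM horner_comp
     !hornerE /= mulr1.
by move=> t; rewrite horner_comp phi_line eqxx !hornerE /= mulrC.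
Qed.

Lemma psiRT1E j : psiRT1 T phi j = fun x => (s *: 'X).[phi j x] *: (x - T j).
Proof.
by apply/funext => x; rewrite /psiRT1 /psiRT0 scalerA !hornerE mulrC.
Qed.

Lemma psiRT2E j : psiRT2 T phi j =
  fun x => (s *: ((5 *: 'X - 2%:P) * 'X)).[phi j x] *: (x - T j).
Proof.
apply/funext => x; rewrite /psiRT2 psiRT1E /= scalerA !hornerE /=.
by congr (_ *: _); ring.
Qed.

Lemma psiRT3E j : psiRT3 T phi j =
  fun x => (s *: ((7^-1 *: (7 *: 'X^2 - 6 *: 'X + 1)) * 'X)).[phi j x] *: (x - T j).
Proof.
apply/funext => x; rewrite /psiRT3 psiRT1E /= scalerA !hornerE /=.
by congr (_ *: _); ring.
Qed.

(** The term of psi_4 of top degree; the other terms belong to the families of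
    lower order and make its divergence orthogonal to P_2. *)
Definition psiRT3_lead x : R * R :=
  (s * (- 2 * phi 1 x ^+ 2 * phi 2 x)) *: (x - T 1).

Lemma psiRT3_4E : psiRT3_4 T phi =
  (2 / 45) *: psiRT1 T phi 0 + ((2 / 9) *: psiRT1 T phi 1 +
  ((3 / 70) *: psiRT2 T phi 0 + ((2 / 70) *: psiRT2 T phi 1 +
  ((- 3 / 70) *: psiRT2 T phi 2 + psiRT3_lead)))).
Proof.
apply/funext => x; rewrite /psiRT3_4 /psiRT3_lead psiRT1E !psiRT2E.
rewrite [LHS]surjective_pairing [RHS]surjective_pairing /= !scaleRE !hornerE /=.
by congr pair; field; rewrite gt_eqF ?area_gt0.
Qed.

Lemma divergence_psiRT1 j y :
  divergence (psiRT1 T phi j) (F y) = s * spoly (divRT1 R j) y.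
Proof.
rewrite psiRT1E divergence_barycentric phi_affine !poly.derivE !hornerE.
by case: (ord3P j) => ->; rewrite /divRT1 /bary !spolyE /=; ring.
Qed.

Lemma divergence_psiRT2 j y :
  divergence (psiRT2 T phi j) (F y) = s * spoly (divRT2 R j) y.
Proof.
rewrite psiRT2E divergence_barycentric phi_affine !poly.derivE !hornerE.
by case: (ord3P j) => ->; rewrite /divRT2 /bary !spolyE /=; ring.
Qed.

Lemma psiRT1_RTint j : RTint 1 T (psiRT1 T phi j).
Proof.
rewrite psiRT1E; apply: RTint_radial => [|x xj].
  have := PolZ s (phi_Pol j); congr Pol; apply/funext => x.
  by rewrite !hornerE.
by rewrite phi_edge// !hornerE /= ?mulr0.
Qed.

Lemma psiRT2_RTint j : RTint 2 T (psiRT2 T phi j).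
Proof.
rewrite psiRT2E; apply: RTint_radial => [|x xj].
  have p := phi_Pol j.
  have := PolZ s (PolM (PolB (PolZ 5 p) (Pol_cst 1 2)) p).
  by congr Pol; apply/funext => x; rewrite !hornerE.
by rewrite phi_edge// !hornerE /= ?mulr0.
Qed.

Lemma psiRT3_RTint j : RTint 3 T (psiRT3 T phi j).
Proof.
rewrite psiRT3E; apply: RTint_radial => [|x xj].
  have p := phi_Pol j; have q := Pol_leq (isT : (1 <= 2)%N) p.
  have := PolZ s (PolM (PolZ 7^-1 (PolD (PolB (PolZ 7 (PolX 2 p)) (PolZ 6 q))
    (Pol_cst 2 1))) p).
  by congr Pol; apply/funext => x; rewrite !hornerE.
by rewrite phi_edge// !hornerE /= ?mulr0.
Qed.

Lemma psiRT3_lead_Pol : Pol 3 (fun x => s * (- 2 * phi 1 x ^+ 2 * phi 2 x)).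
Proof. exact: (PolZ s (PolM (PolZ (- 2) (PolX 2 (phi_Pol 1))) (phi_Pol 2))). Qed.

Lemma psiRT3_lead_RTint : RTint 3 T psiRT3_lead.
Proof.
apply: RTint_radial => [|x xj]; first exact: psiRT3_lead_Pol.
by rewrite phi_edge// expr2; ring.
Qed.

Lemma divergence_psiRT3_lead y : divergence psiRT3_lead (F y) =
  s * (- 10 * y.1 ^+ 2 * y.2 + 4 * y.1 * y.2).
Proof.
rewrite (divergence_radial _ _ psiRT3_lead_Pol).
pose l i (b : R) : {poly R} := (bary y i)%:P + b *: 'X.
rewrite (@derive_line _ _ _ _ (s *: (-2 *: (l 1 (y.1 - 1) ^+ 2 * l 2 y.2)))).
  rewrite !phi_affine /l /bary /= !poly.derivE !hornerE /=; ring.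
move=> t; rewrite !phi_line !phi_affine /l /bary !hornerE /=; ring.
Qed.

End Basis.

(** * Families that raise the polynomial degree by one *)
Section Enrichment.
Variables (R : realType) (T : triangle R).
Implicit Types (f g q r : R * R -> R) (x y : R * R) (u v : R * R -> R * R).
Notation F := (affine_map T).

(** A polynomial field is determined by its restriction to T, which makes linear
    independence on T the same as linear independence on the plane. *)
Lemma Pol_eq0_triangle k f :
  Pol k f -> (forall x, tri_set T x -> f x = 0) -> forall x, f x = 0.
Proof.
move=> /(Pol_affine T) fP f0 x; rewrite -(affine_invK T x).
apply: (Pol_eq0_simplex fP) => y yS; apply: f0; exact/tri_set_affine.
Qed.

Lemma Pol_orthogonal_self_triangle k r : (k <= 2)%N -> Pol k r ->
  (forall g, Pol k g -> tri_int T (fun x => r x * g x) = 0) ->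
  forall x, r x = 0.
Proof.
move=> k2 rP orth x; rewrite -(affine_invK T x).
apply: (Pol_orthogonal_self k2 (Pol_affine T rP)) => g gP.
have gE : (fun y => g (affine_inv T (F y))) = g.
  by apply/funext => y; rewrite affine_mapK.
have gP' : Pol k (fun x => g (affine_inv T x)).
  by apply: (@Pol_affine_inv _ T); rewrite gE.
have C0 : 2 * area T != 0 by rewrite mulf_neq0 ?pnatr_eq0// gt_eqF// area_gt0.
have := orth _ gP'; rewrite (tri_int_affine T (PolM rP gP')) => /eqP.
rewrite mulf_eq0 (negPf C0) /= => /eqP <-.
by congr simplex_int; apply/funext => y; rewrite affine_mapK.
Qed.

Lemma tri_int_lin k a f g : Pol k f -> Pol k g ->
  tri_int T (fun x => f x + a * g x) = tri_int T f + a * tri_int T g.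
Proof.
move=> fP gP; rewrite (tri_int_affine T (Pol_lin a fP gP)).
rewrite (tri_int_affine T fP) (tri_int_affine T gP).
rewrite (simplex_int_lin a (Pol_affine T fP) (Pol_affine T gP)); ring.
Qed.

(** The properties by which psi extends the range of the divergence from degree k
    to degree k + 1; the last field says that the leading forms of the divergences
    span the forms of degree k + 1. *)
Record enrichment (k n : nat) (psi : 'I_n -> R * R -> R * R) : Prop := Enrichment {
  enrichment_RTint : forall i, RTint k.+1 T (psi i);
  enrichment_orthogonal : forall i g, Pol k g ->
    tri_int T (fun x => divergence (psi i) x * g x) = 0;
  enrichment_free : forall c : 'I_n -> R,
    (forall x, tri_set T x -> \sum_i c i * divergence (psi i) x = 0) ->
    forall i, c i = 0;
  enrichment_top : forall q, Pol k.+1 q -> exists c : 'I_n -> R,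
    Pol k (fun x => q x - \sum_i c i * divergence (psi i) x) }.

(** Everything except the boundary condition can be checked on the divergences in
    the chart, up to a common factor. *)
Lemma enrichment_of_reference k n (psi : 'I_n -> R * R -> R * R)
    (d : 'I_n -> R * R -> R) (a : R) :
    a != 0 -> (forall i, Pol k.+1 (d i)) -> (forall i, RTint k.+1 T (psi i)) ->
    (forall i y, divergence (psi i) (F y) = a * d i y) ->
    (forall i g, Pol k g -> simplex_int (fun y => d i y * g y) = 0) ->
    (forall c : 'I_n -> R,
      (forall y, simplex y -> \sum_i c i * d i y = 0) -> forall i, c i = 0) ->
    (forall q, Pol k.+1 q -> exists c : 'I_n -> R,
      Pol k (fun y => q y - \sum_i c i * d i y)) ->
  enrichment k psi.
Proof.
move=> a0 dP psiRT divE orth free top.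
have divP i : Pol k.+1 (divergence (psi i)).
  exact: polyfield_divergence (RT_polyfield (psiRT i).1).
split => // [i g gP|c c0 i|q qP].
- rewrite (tri_int_affine T (PolM (divP i) gP)).
  have dgP := PolM (dP i) (Pol_affine T gP).
  rewrite [X in simplex_int X](_ : _ = fun y => a * (d i y * g (F y))).
    by rewrite (simplex_intZ _ dgP) orth ?mulr0//; exact: Pol_affine.
  by apply/funext => y; rewrite divE mulrA.
- apply: (free c) => y yS; apply: (mulfI a0); rewrite mulr0.
  rewrite -[RHS](c0 (F y) ((tri_set_affine T y).2 yS)).
  by rewrite mulr_sumr; apply: eq_bigr => j _; rewrite divE mulrCA.
- have [c cP] := top _ (Pol_affine T qP).
  exists (fun i => c i / a); apply: (@Pol_affine_inv _ T).
  congr Pol: cP; apply/funext => y; congr (_ - _); apply: eq_bigr => i _.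
  by rewrite divE mulrA divfK.
Qed.

Section Bijection.
Variables (k n : nat) (psi : 'I_n -> R * R -> R * R).
Hypotheses (k2 : (k <= 2)%N) (psiE : enrichment k psi).

Let psiP i : polyfield k.+2 (psi i).
Proof. exact: RT_polyfield (enrichment_RTint psiE i).1. Qed.

Let divP i : Pol k.+1 (divergence (psi i)).
Proof. exact: polyfield_divergence (psiP i). Qed.

(** A combination that vanishes on T vanishes on the plane, so its divergence
    vanishes, and the divergences are independent. *)
Lemma enrichment_lin_indep : lin_indep T psi.
Proof.
move=> c c0; apply: (enrichment_free psiE) => x _.
rewrite -(divergence_sum c x psiP).
have [v1P v2P] := polyfield_sum c psiP.
have v0 z : tri_set T z -> (\sum_i c i *: psi i) z = 0.
  by move=> /c0 <-; rewrite fct_sumE.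
have -> : \sum_i c i *: psi i = 0 :> (R * R -> R * R).
  apply/funext => z; rewrite [LHS]surjective_pairing; congr pair.
  - by apply: (Pol_eq0_triangle v1P) => {}z /v0 ->.
  - by apply: (Pol_eq0_triangle v2P) => {}z /v0 ->.
exact: divergence0.
Qed.

Lemma tri_int_sum_orthogonal (c : 'I_n -> R) g : Pol k g ->
  tri_int T (fun x => (\sum_i c i * divergence (psi i) x) * g x) = 0.
Proof.
move=> gP; have fP i := Pol_affine T (PolM (divP i) gP).
have sP := Pol_sum (fun i => PolZ (c i) (divP i)).
rewrite (tri_int_affine T (PolM sP gP)).
rewrite [X in simplex_int X](_ : _ = fun y => \sum_i c i *
    (divergence (psi i) (F y) * g (F y))); last first.
  by apply/funext => y; rewrite mulr_suml; apply: eq_bigr => i _; rewrite mulrA.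
rewrite (simplex_int_sum _ fP) mulr_sumr big1// => i _.
rewrite mulrCA -(tri_int_affine T (PolM (divP i) gP)).
by rewrite (enrichment_orthogonal psiE) ?mulr0.
Qed.

(** Injectivity is the independence of the divergences.  For surjectivity, the
    remainder after matching leading forms has degree k and is orthogonal to P_k,
    hence zero. *)
Lemma enrichment_bij :
  set_bij (lspan psi) (Qperp T k.+1 (@Pol R k)) (@divergence R).
Proof.
split.
- move=> _ [c ->]; have dE x := divergence_sum c x psiP.
  rewrite (_ : divergence _ = fun x => \sum_i c i * divergence (psi i) x).
    split; first exact: (Pol_sum (fun i => PolZ (c i) (divP i))).
    by move=> g gP; exact: tri_int_sum_orthogonal.
  exact/funext.
- move=> _ _ /set_mem[c ->] /set_mem[d ->] cd.
  suff -> : c = d by [].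
  apply/funext => i; apply/eqP; rewrite -subr_eq0; apply/eqP; move: i.
  apply: (enrichment_free psiE) => x _.
  have /= := congr1 (fun h => h x) cd.
  rewrite !(divergence_sum _ x psiP) => e.
  by under eq_bigr do rewrite mulrBl; rewrite sumrB e subrr.
- move=> q [qP qorth]; have [c cP] := enrichment_top psiE qP.
  exists (\sum_i c i *: psi i); first by exists c.
  apply/funext => x; rewrite (divergence_sum c x psiP).
  apply/eqP; rewrite eq_sym -subr_eq0; apply/eqP.
  apply: (Pol_orthogonal_self_triangle k2 cP) => g gP.
  have sP := Pol_sum (fun i => PolZ (c i) (divP i)).
  transitivity (tri_int T (fun x => q x * g x) + (-1) * tri_int T (fun x =>
      (\sum_i c i * divergence (psi i) x) * g x)).
    rewrite -(tri_int_lin _ (PolM qP gP) (PolM sP gP)).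
    by congr tri_int; apply/funext => z; rewrite mulrBl mulN1r.
  by rewrite tri_int_sum_orthogonal// qorth// mulr0 addr0.
Qed.

End Bijection.
End Enrichment.

(** * The three families of the theorem *)
Section Families.
Variables (R : realType) (T : triangle R) (phi : 'I_3 -> R * R -> R).
Hypothesis phiT : nodal_basis T phi.
Notation F := (affine_map T).
Notation s := (2 * area T)^-1.
Notation widen23 := (widen_ord (isT : (2 <= 3)%N)).

Lemma familyRT3_lift (i : 'I_3) : familyRT3 T phi (lift ord_max i) = psiRT3 T phi i.
Proof. by rewrite /familyRT3 liftK. Qed.

Lemma familyRT3_last : familyRT3 T phi ord_max = psiRT3_4 T phi.
Proof. by rewrite /familyRT3 unlift_none. Qed.

Lemma psiRT3_4_RTint : RTint 3 T (psiRT3_4 T phi).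
Proof.
have p1 j := RTint_leq (isT : (1 <= 3)%N) (psiRT1_RTint phiT j).
have p2 j := RTint_leq (isT : (2 <= 3)%N) (psiRT2_RTint phiT j).
by rewrite psiRT3_4E; do ?apply: RTint_lin => //; exact: psiRT3_lead_RTint.
Qed.

Lemma familyRT3_RTint i : RTint 3 T (familyRT3 T phi i).
Proof.
case: (unliftP ord_max i) => [j|] ->.
- by rewrite familyRT3_lift; exact: psiRT3_RTint.
- by rewrite familyRT3_last; exact: psiRT3_4_RTint.
Qed.

Lemma divergence_psiRT3 j y :
  divergence (psiRT3 T phi j) (F y) = s * spoly (divRT3 R (lift ord_max j)) y.
Proof.
rewrite psiRT3E divergence_barycentric// phi_affine// !poly.derivE !hornerE.
by case: (ord3P j) => ->; rewrite /divRT3 /bary !spolyE /=; field;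
  rewrite gt_eqF ?area_gt0.
Qed.

Lemma divergence_psiRT3_4 y :
  divergence (psiRT3_4 T phi) (F y) = s * spoly (divRT3 R ord_max) y.
Proof.
have p1 j := RT_polyfield (RTint_leq (isT : (1 <= 3)%N) (psiRT1_RTint phiT j)).1.
have p2 j := RT_polyfield (RTint_leq (isT : (2 <= 3)%N) (psiRT2_RTint phiT j)).1.
have p3 := RT_polyfield (psiRT3_lead_RTint phiT).1.
rewrite psiRT3_4E.
have q1 := polyfield_lin (- 3 / 70) (p2 2) p3.
have q2 := polyfield_lin (2 / 70) (p2 1) q1.
have q3 := polyfield_lin (3 / 70) (p2 0) q2.
have q4 := polyfield_lin (2 / 9) (p1 1) q3.
rewrite (divergence_lin _ _ (p1 0) q4) (divergence_lin _ _ (p1 1) q3).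
rewrite (divergence_lin _ _ (p2 0) q2) (divergence_lin _ _ (p2 1) q1).
rewrite (divergence_lin _ _ (p2 2) p3) (divergence_psiRT3_lead phiT).
rewrite !(divergence_psiRT1 phiT) !(divergence_psiRT2 phiT).
rewrite /divRT1 /divRT2 /divRT3 !spolyE /=; by field; rewrite gt_eqF ?area_gt0.
Qed.

Lemma divergence_familyRT3 i y :
  divergence (familyRT3 T phi i) (F y) = s * spoly (divRT3 R i) y.
Proof.
case: (unliftP ord_max i) => [j|] ->.
- by rewrite familyRT3_lift divergence_psiRT3.
- by rewrite familyRT3_last divergence_psiRT3_4.
Qed.

Let s_neq0 : s != 0.
Proof. by rewrite invr_neq0// mulf_neq0 ?pnatr_eq0// gt_eqF// area_gt0. Qed.

Lemma familyRT1_enrichment : enrichment T 0 (familyRT1 T phi).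
Proof.
apply: (@enrichment_of_reference _ _ _ _ _ (fun i => spoly (divRT1 R (widen23 i))) s) => //.
- by move=> i; apply: Pol_spoly; case: (ord2P i) => ->.
- by move=> i; exact: psiRT1_RTint.
- by move=> i y; exact: divergence_psiRT1.
- by move=> i g; exact: divRT1_orthogonal.
- exact: divRT1_free.
- exact: divRT1_top.
Qed.

Lemma psiRT2_enrichment : enrichment T 1 (psiRT2 T phi).
Proof.
apply: (@enrichment_of_reference _ _ _ _ _ (fun i => spoly (divRT2 R i)) s) => //.
- by move=> i; apply: Pol_spoly; case: (ord3P i) => ->.
- by move=> i; exact: psiRT2_RTint.
- by move=> i y; exact: divergence_psiRT2.
- by move=> i g; exact: divRT2_orthogonal.
- exact: divRT2_free.
- exact: divRT2_top.
Qed.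

Lemma familyRT3_enrichment : enrichment T 2 (familyRT3 T phi).
Proof.
apply: (@enrichment_of_reference _ _ _ _ _ (fun i => spoly (divRT3 R i)) s) => //.
- by move=> i; apply: Pol_spoly; case: (ord4P i) => ->.
- by move=> i; exact: familyRT3_RTint.
- by move=> i y; exact: divergence_familyRT3.
- by move=> i g; exact: divRT3_orthogonal.
- exact: divRT3_free.
- exact: divRT3_top.
Qed.

End Families.

(** * Complements of the divergence-free fields *)
Definition fam_cat (V : Type) n p (f : 'I_n -> V) (g : 'I_p -> V) (i : 'I_(n + p)) : V :=
  match fintype.split i with inl j => f j | inr j => g j end.

Section Concatenation.
Variables (V : Type) (n p : nat) (f : 'I_n -> V) (g : 'I_p -> V).

Lemma fam_catl i : fam_cat f g (lshift p i) = f i.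
Proof. by rewrite /fam_cat (unsplitK (inl _ i)). Qed.

Lemma fam_catr i : fam_cat f g (rshift n i) = g i.
Proof. by rewrite /fam_cat (unsplitK (inr _ i)). Qed.

Lemma fam_catP (P : V -> Prop) :
  (forall i, P (f i)) -> (forall i, P (g i)) -> forall i, P (fam_cat f g i).
Proof. by move=> Pf Pg i; rewrite /fam_cat; case: fintype.split. Qed.

Lemma sum_fam_cat (W : nmodType) (a : 'I_(n + p) -> V -> W) :
  \sum_i a i (fam_cat f g i) =
  \sum_i a (lshift p i) (f i) + \sum_i a (rshift n i) (g i).
Proof.
by rewrite big_split_ord; congr (_ + _); apply: eq_bigr => i _;
  rewrite ?fam_catl ?fam_catr.
Qed.

End Concatenation.

Section Span.
Variable R : realType.

Lemma lspan_mem n (f : 'I_n -> R * R -> R * R) i : lspan f (f i).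
Proof.
exists (fun j => (j == i)%:R); rewrite (bigD1 i)//= eqxx scale1r big1 ?addr0//.
by move=> j /negPf->; rewrite scale0r.
Qed.

Lemma lspan_subspace n (f : 'I_n -> R * R -> R * R) : is_subspace (lspan f).
Proof.
split; first by exists (fun=> 0); rewrite big1// => i _; rewrite scale0r.
move=> a _ _ [c ->] [d ->]; exists (fun i => a * c i + d i).
rewrite scaler_sumr -big_split /=; apply: eq_bigr => i _.
by rewrite scalerA scalerDl.
Qed.

End Span.

Section DivergenceBasis.
Variables (R : realType) (T : triangle R).
Notation F := (affine_map T).

(** The divergence is a bijection from the span of f onto the polynomials of degree
    m with mean value zero; by the divergence theorem a larger range is
    impossible. *)
Record div_basis (m n : nat) (f : 'I_n -> R * R -> R * R) : Prop := DivBasis {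
  div_basis_RTint : forall i, RTint m T (f i);
  div_basis_free : forall c : 'I_n -> R,
    (forall x, tri_set T x -> \sum_i c i * divergence (f i) x = 0) ->
    forall i, c i = 0;
  div_basis_onto : forall q, Pol m q -> tri_int T q = 0 ->
    exists c : 'I_n -> R, forall x, q x = \sum_i c i * divergence (f i) x }.

Lemma div_basis0 (f : 'I_0 -> R * R -> R * R) : div_basis 0 f.
Proof.
split=> [[]//|c _ []//|q qP q0]; exists (fun=> 0) => x; rewrite big_ord0.
apply: (Pol_orthogonal_self_triangle (isT : (0 <= 2)%N) qP) => g /Pol0_cst[b gE].
transitivity (tri_int T (fun=> 0) + b * tri_int T q); last first.
  by rewrite q0 mulr0 addr0 (tri_int_affine T (Pol0 R 0)) simplex_int0 mulr0.
rewrite -(tri_int_lin T b (Pol0 R 0) qP); congr tri_int; apply/funext => z.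
by rewrite gE add0r mulrC.
Qed.

(** The divergences of g are orthogonal to P_m, those of f lie in P_m; so in a
    vanishing combination both parts vanish separately.  For a given q the family
    g matches the leading form, and what remains has degree m and still has mean
    value zero. *)
Lemma div_basis_enrich m n p (f : 'I_n -> R * R -> R * R)
    (g : 'I_p -> R * R -> R * R) :
  (m <= 2)%N -> div_basis m f -> enrichment T m g -> div_basis m.+1 (fam_cat f g).
Proof.
move=> m2 fB gE; split.
- apply: fam_catP => i; first exact: RTint_leq (div_basis_RTint fB i).
  exact: (enrichment_RTint gE).
- move=> c c0.
  have fP i : Pol m (divergence (f i)).
    exact: polyfield_divergence (RT_polyfield (div_basis_RTint fB i).1).
  have gP i : Pol m.+1 (divergence (g i)).
    exact: polyfield_divergence (RT_polyfield (enrichment_RTint gE i).1).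
  pose r x := \sum_i c (lshift p i) * divergence (f i) x.
  pose t x := \sum_i c (rshift n i) * divergence (g i) x.
  have rP : Pol m r by exact: (Pol_sum (fun i => PolZ _ (fP i))).
  have tP : Pol m.+1 t by exact: (Pol_sum (fun i => PolZ _ (gP i))).
  have rt x : tri_set T x -> r x + t x = 0.
    move=> /c0 <-.
    by rewrite (sum_fam_cat f g (fun i v => c i * divergence v x)).
  (* On T the sum r is the negative of a sum orthogonal to P_m. *)
  have r0 : forall x, r x = 0.
    apply: (Pol_orthogonal_self_triangle m2 rP) => h hP.
    transitivity (tri_int T (fun x => r x * h x) + 1 * tri_int T (fun x => t x * h x)).
      by rewrite (tri_int_sum_orthogonal gE)// mulr0 addr0.
    have rhP : Pol (m.+1 + m) (fun x => r x * h x).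
      by apply: Pol_leq (PolM rP hP); rewrite leq_add2r.
    rewrite -(tri_int_lin T 1 rhP (PolM tP hP)).
    rewrite -[RHS](mul0r (fine (plane_measure R (tri_set T)))).
    rewrite -Rintegral_cst; last exact: measurable_tri_set.
    apply: eq_Rintegral => x /set_mem xT.
    by rewrite mul1r -mulrDl rt// mul0r.
  move=> i; rewrite -(splitK i); case: fintype.split => j /=.
  - by apply: (div_basis_free fB (c := fun j => c (lshift p j))) => x _; exact: r0.
  - apply: (enrichment_free gE (c := fun j => c (rshift n j))) => x /rt.
    by rewrite r0 add0r.
- move=> q qP q0; have [e eP] := enrichment_top gE qP.
  have [|c cE] := div_basis_onto fB eP.
    have sP : Pol m.+1 (fun x => \sum_i e i * divergence (g i) x).
      apply: Pol_sum => i; apply: PolZ.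
      exact: polyfield_divergence (RT_polyfield (enrichment_RTint gE i).1).
    have := tri_int_sum_orthogonal gE e (Pol_cst m 1).
    under [X in tri_int _ X]eq_fun do rewrite mulr1.
    move=> s0; transitivity (tri_int T q +
        (-1) * tri_int T (fun x => \sum_i e i * divergence (g i) x)).
      rewrite -(tri_int_lin T (-1) qP sP).
      by congr tri_int; apply/funext => x; rewrite mulN1r.
    by rewrite q0 s0 mulr0 addr0.
  exists (fam_cat c e) => x.
  transitivity (\sum_i c i * divergence (f i) x + \sum_i e i * divergence (g i) x).
    by rewrite -cE subrK.
  rewrite big_split_ord; congr (_ + _); apply: eq_bigr => i _;
    by rewrite ?fam_catl ?fam_catr.
Qed.

(** Subtract from v the element of the span with the same divergence. *)
Lemma div_basis_complement m n (f : 'I_n -> R * R -> R * R) : div_basis m f ->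
  is_complement (RTint m T) (RTint_divfree m T) (lspan f).
Proof.
move=> fB; have fP i := RT_polyfield (div_basis_RTint fB i).1.
split; first exact: lspan_subspace.
- by move=> _ [c ->]; apply: RTint_sum; exact: (div_basis_RTint fB).
- apply/seteqP; split=> [_ [[c ->] [_ d0]]|_ ->]; last first.
    split; first by case: (lspan_subspace f).
    by split; [exact: RTint0|move=> x _; exact: divergence0].
  rewrite /set1 /= big1// => i _.
  rewrite (div_basis_free fB (c := c)) ?scale0r// => x /d0.
  by rewrite (divergence_sum _ _ fP).
- move=> v vR; have vP := RT_polyfield vR.1.
  have [c cE] := div_basis_onto fB (polyfield_divergence vP) (tri_int_divergence vR).
  pose w := \sum_i c i *: f i.
  have wR : RTint m T w by apply: RTint_sum; exact: (div_basis_RTint fB).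
  exists w, ((-1) *: w + v); split; first by exists c.
  + split; first exact: RTint_lin.
    move=> x _; rewrite (divergence_lin _ _ (RT_polyfield wR.1) vP).
    by rewrite (divergence_sum _ _ fP) cE mulN1r addNr.
  + by rewrite scaleN1r addrA subrr add0r.
Qed.

End DivergenceBasis.

(** * The Piola transformation *)
Section Piola.
Variable R : realType.

Definition ref_vertex (j : 'I_3) : R * R := ((j == 1)%:R, (j == 2)%:R).

Lemma ref_nondeg :
  cross (ref_vertex 1 - ref_vertex 0) (ref_vertex 2 - ref_vertex 0) != 0.
Proof.
rewrite (_ : cross _ _ = 1) ?oner_neq0//.
by rewrite /cross /ref_vertex /=; ring.
Qed.

Definition ref_triangle : triangle R := Triangle ref_nondeg.
Definition ref_phi (j : 'I_3) (y : R * R) : R := bary y j.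

Variables (T : triangle R) (phi : 'I_3 -> R * R -> R).
Hypothesis phiT : nodal_basis T phi.
Notation F := (affine_map T).
Notation D := (affine_det T).

(** The constant by which the basis functions on T differ from the Piola transforms
    of those on the reference triangle; it is 1 or -1, according to the
    orientation of T. *)
Definition piola_kappa : R := D * (2 * area T)^-1 * (2 * area ref_triangle).

Lemma piola_kappa_neq0 : piola_kappa != 0.
Proof.
by rewrite !mulf_neq0 ?invr_neq0 ?mulf_neq0 ?pnatr_eq0 ?affine_det_neq0//
  gt_eqF// area_gt0.
Qed.

Let P (w : R * R) : R * R := piola_kappa *: (D^-1 *: affine_lin T w).

Let PD u v : P (u + v) = P u + P v.
Proof.
rewrite /P /affine_lin [LHS]surjective_pairing [RHS]surjective_pairing /= !scaleRE.
by congr pair; ring.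
Qed.

Let PZ a u : P (a *: u) = a *: P u.
Proof.
rewrite /P /affine_lin [LHS]surjective_pairing [RHS]surjective_pairing /= !scaleRE.
by congr pair; ring.
Qed.

Let PB u v : P (u - v) = P u - P v.
Proof. by rewrite PD -scaleN1r PZ scaleN1r. Qed.

Let psi1 j y : psiRT1 T phi j (F y) = P (psiRT1 ref_triangle ref_phi j y).
Proof.
rewrite /psiRT1 /psiRT0 PZ (phi_affine phiT); congr (_ *: _).
have -> : F y - T j = affine_lin T (y - ref_vertex j).
  rewrite [LHS]surjective_pairing [RHS]surjective_pairing affine_mapE.
  by case: (ord3P j) => ->; rewrite /ref_vertex /affine_lin /= !scaleRE; congr pair; ring.
have kE (d a b : R) : d != 0 -> a != 0 -> b != 0 ->
    a^-1 = b^-1 * (d * a^-1 * b * d^-1).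
  by move=> d0 a0 b0; field; rewrite d0 a0 b0.
have area0 (T' : triangle R) : 2 * area T' != 0.
  by rewrite mulf_neq0 ?pnatr_eq0// gt_eqF ?area_gt0.
rewrite PZ /P [piola_kappa *: _]scalerA [RHS]scalerA /piola_kappa.
by rewrite -(kE _ _ _ (affine_det_neq0 T) (area0 T) (area0 ref_triangle)).
Qed.

Let psi2 j y : psiRT2 T phi j (F y) = P (psiRT2 ref_triangle ref_phi j y).
Proof. by rewrite /psiRT2 psi1 (phi_affine phiT) -PZ. Qed.

Let psi3 j y : familyRT3 T phi j (F y) = P (familyRT3 ref_triangle ref_phi j y).
Proof.
rewrite /familyRT3; case: unlift => [i|].
- by rewrite /psiRT3 psi1 (phi_affine phiT) -PZ.
- by rewrite /psiRT3_4 !psi1 !psi2 !(phi_affine phiT) -!PZ -!PD -PB -!PZ -!PD.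
Qed.

Definition familyRT1_2 (T : triangle R) phi := fam_cat (familyRT1 T phi) (psiRT2 T phi).
Definition familyRT1_2_3 (T : triangle R) phi := fam_cat (familyRT1_2 T phi) (familyRT3 T phi).

(** A factor common to all members of a family does not change the span. *)
Lemma lspan_piola n (f g : 'I_n -> R * R -> R * R) :
  (forall i y, f i (F y) = P (g i y)) -> lspan f = piola_image T (lspan g).
Proof.
move=> fg; have k0 := piola_kappa_neq0.
have Psum (c : 'I_n -> R) y :
    (\sum_i c i *: f i) (F y) = P ((\sum_i c i *: g i) y).
  rewrite !fct_sumE; elim/big_rec2: _ => [|i u v _ ->].
    by have := PZ 0 0; rewrite !scale0r.
  by rewrite PD PZ -fg.
apply/seteqP; split=> [_ [c ->]|v [_ [c ->] vE]].
- exists (piola_kappa *: \sum_i c i *: g i).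
    exists (fun i => piola_kappa * c i); rewrite scaler_sumr.
    by apply: eq_bigr => i _; rewrite scalerA.
  by move=> y; rewrite Psum -[RHS](scalerK k0) -/(P _) PZ scalerK.
- exists (fun i => piola_kappa^-1 * c i); apply/funext => x.
  rewrite -(affine_invK T x) vE Psum.
  have -> : \sum_i (piola_kappa^-1 * c i) *: g i = piola_kappa^-1 *: \sum_i c i *: g i.
    by rewrite scaler_sumr; apply: eq_bigr => i _; rewrite scalerA.
  by rewrite [RHS]PZ /P scalerK.
Qed.

Lemma familyRT1_piola :
  lspan (familyRT1 T phi) = piola_image T (lspan (familyRT1 ref_triangle ref_phi)).
Proof. by apply: lspan_piola => i y; exact: psi1. Qed.

Lemma familyRT1_2_piola :
  lspan (familyRT1_2 T phi) = piola_image T (lspan (familyRT1_2 ref_triangle ref_phi)).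
Proof.
apply: lspan_piola => i y; rewrite /familyRT1_2 /fam_cat.
by case: fintype.split => j; [exact: psi1|exact: psi2].
Qed.

Lemma familyRT1_2_3_piola :
  lspan (familyRT1_2_3 T phi) = piola_image T (lspan (familyRT1_2_3 ref_triangle ref_phi)).
Proof.
apply: lspan_piola => i y; rewrite /familyRT1_2_3 /familyRT1_2 /fam_cat.
by case: fintype.split => j; [case: fintype.split => {}j; [exact: psi1|exact: psi2]|exact: psi3].
Qed.

End Piola.

(** * The space of lowest order *)
Section LowestOrder.
Variables (R : realType) (T : triangle R) (phi : 'I_3 -> R * R -> R).
Hypothesis phiT : nodal_basis T phi.
Notation F := (affine_map T).
Notation D := (affine_det T).

(** The two cross products are the coordinates with respect to the edge vectors,
    up to the determinant. *)
Lemma cross_edges_inj u w : cross u (T 2 - T 0) = cross w (T 2 - T 0) ->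
  cross (T 1 - T 0) u = cross (T 1 - T 0) w -> u = w.
Proof.
move=> uw1 uw2.
have dec z : D * z.1 = cross z (T 2 - T 0) * (T 1 - T 0).1 + cross (T 1 - T 0) z * (T 2 - T 0).1
    /\ D * z.2 = cross z (T 2 - T 0) * (T 1 - T 0).2 + cross (T 1 - T 0) z * (T 2 - T 0).2.
  by rewrite /affine_det /cross /=; split; ring.
have [u1 u2] := dec u; have [w1 w2] := dec w.
have D0 := affine_det_neq0 T.
rewrite [LHS]surjective_pairing [RHS]surjective_pairing; congr pair; apply: (mulfI D0).
- by rewrite u1 w1 uw1 uw2.
- by rewrite u2 w2 uw1 uw2.
Qed.

(** In the chart a field of RT_1 is (a + b y1 + c y2 + q y1, a' + b' y1 + c' y2 +
    q y2) with q = d + e y1 + h y2.  Tangentiality on the three edges leaves only e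
    and h free, and the field is - h f_1 + (e - h) f_2, where f_1 and f_2 are the
    pulled back basis functions up to a factor. *)
Lemma RTint1_lspan : RTint 1 T = lspan (familyRT1 T phi).
Proof.
apply/seteqP; split=> [v vR|_ [c ->]]; last first.
  by apply: RTint_sum => i; exact: psiRT1_RTint.
have [[p1 [p2 [q [p1P p2P qP vE]]]] _] := vR.
have [[p1F p2F] qF] := (Pol_affine T p1P, Pol_affine T p2P, Pol_affine T qP).
have [a [b [c pE1]]] := Pol1E (PolD (PolB (PolZ (T 2 - T 0).2 p1F)
  (PolZ (T 2 - T 0).1 p2F)) (PolZ (cross (T 0) (T 2 - T 0)) qF)).
have [a' [b' [c' pE2]]] := Pol1E (PolD (PolB (PolZ (T 1 - T 0).1 p2F)
  (PolZ (T 1 - T 0).2 p1F)) (PolZ (cross (T 1 - T 0) (T 0)) qF)).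
have [d [e [h qE]]] := Pol1E (PolZ D qF).
have vE1 y : cross (v (F y)) (T 2 - T 0) =
    a + b * y.1 + c * y.2 + (d + e * y.1 + h * y.2) * y.1.
  rewrite -pE1 -qE vE /= /cross /= affine_mapE /= !scaleRE /affine_det /cross /=.
  by move: (p1 _) (p2 _) (q _) => *; ring.
have vE2 y : cross (T 1 - T 0) (v (F y)) =
    a' + b' * y.1 + c' * y.2 + (d + e * y.1 + h * y.2) * y.2.
  rewrite -pE2 -qE vE /= /cross /= affine_mapE /= !scaleRE /affine_det /cross /=.
  by move: (p1 _) (p2 _) (q _) => *; ring.
have [] : 0 <= (0 : R) <= 1 by rewrite lexx ler01.
move=> /(RTint_pullback vR); rewrite /pullback !vE1 !vE2 /= => -[h1 h2 h3].
have [] : 0 <= (1 : R) <= 1 by rewrite lexx ler01.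
move=> /(RTint_pullback vR); rewrite /pullback !vE1 !vE2 /= => -[h4 h5 h6].
(* The boundary conditions are linear in t, so t = 0 and t = 1 suffice. *)
have [a0 c0 bE] : [/\ a = 0, c = 0 & b = - e - d] by split; lra.
have [a0' b0' cE'] : [/\ a' = 0, b' = 0 & c' = - h - d] by split; lra.
(* The factor that turns f_i back into the i-th basis function. *)
pose k := 2 * area T / D.
have kK : (2 * area T)^-1 * k * D = 1 :> R.
  have := affine_det_neq0 T; have := area_gt0 T; rewrite lt0r => /andP[A0 _] D0.
  by rewrite /k; field; rewrite A0 D0.
exists (fun i : 'I_2 => k * [:: - h; e - h]`_i).
apply/funext => x; rewrite -(affine_invK T x); move: (affine_inv T x) => y.
have w0 : widen_ord (isT : (2 <= 3)%N) 0 = 0 by exact: val_inj.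
have w1 : widen_ord (isT : (2 <= 3)%N) 1 = 1 by exact: val_inj.
transitivity ((k * - h) *: psiRT1 T phi 0 (F y) +
              (k * (e - h)) *: psiRT1 T phi 1 (F y)); last first.
  by rewrite fct_sumE sum2E /familyRT1 w0 w1.
rewrite /psiRT1 /psiRT0 !(phi_affine phiT) /bary /=.
apply: cross_edges_inj; rewrite ?vE1 ?vE2.
- rewrite affine_mapE a0 c0 bE /cross /= !scaleRE.
  transitivity (((2 * area T)^-1 * k * D) * (- e * y.1 + e * y.1 ^+ 2 + h * y.1 * y.2)).
    by rewrite kK; ring.
  by rewrite /affine_det /cross /=; move: ((2 * area T)^-1) => s; ring.
- rewrite affine_mapE a0' b0' cE' /cross /= !scaleRE.
  transitivity (((2 * area T)^-1 * k * D) * (- h * y.2 + e * y.1 * y.2 + h * y.2 ^+ 2)).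
    by rewrite kK; ring.
  by rewrite /affine_det /cross /=; move: ((2 * area T)^-1) => s; ring.
Qed.

(** The lowest-order family enriches the empty one, whose divergences span the
    polynomials of degree 0 with mean value zero. *)
Lemma div_basis1 : div_basis T 1 (familyRT1 T phi).
Proof.
have eB := @div_basis_enrich R T 0 0 2 (fun=> 0) (familyRT1 T phi) isT (div_basis0 T _)
  (familyRT1_enrichment phiT).
split.
- by move=> i; exact: psiRT1_RTint.
- exact: (enrichment_free (familyRT1_enrichment phiT)).
- move=> q qP q0; have [c cE] := div_basis_onto eB qP q0.
  exists (fun i => c (rshift 0 i)) => x; rewrite cE.
  by rewrite (sum_fam_cat _ _ (fun i v => c i * divergence v x)) big_ord0 add0r.
Qed.

End LowestOrder.

Theorem lemma2p2 (R : realType) (Th : set (triangle R))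
    (phi : triangle R -> 'I_3 -> R * R -> R)
    (hphi : forall T, Th T -> nodal_basis T (phi T)) :
  [/\ (* (a) *)
      RTtilde Th 1 (RTint 1) /\
      forall W, RTtilde Th 1 W -> forall T, Th T ->
        let psi := familyRT1 T (phi T) in
        [/\ forall j, W T (psi j),
            lin_indep T psi,
            forall j, tri_int T (divergence (psi j)) = 0,
            lspan psi = W T
          & set_bij (lspan psi) (Qperp T 1 (@Pol R 0)) (@divergence R)],
      (* (b) *)
      exists W, RTtilde Th 2 W /\ forall T, Th T ->
        let psi := psiRT2 T (phi T) in
        [/\ forall j, W T (psi j),
            lin_indep T psi,
            forall j k, tri_int T (fun x => divergence (psi j) x * phi T k x) = 0
          & set_bij (lspan psi) (Qperp T 2 (@Pol R 1)) (@divergence R)]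
    & (* (c) *)
      exists W, RTtilde Th 3 W /\ forall T, Th T ->
        let psi := familyRT3 T (phi T) in
        [/\ forall j, W T (psi j),
            lin_indep T psi,
            forall j lambda, Pol 2 lambda ->
              tri_int T (fun x => divergence (psi j) x * lambda x) = 0
          & set_bij (lspan psi) (Qperp T 3 (@Pol R 2)) (@divergence R)]].
Proof.
have basis12 T : Th T -> div_basis T 2 (familyRT1_2 T (phi T)).
  move=> /hphi phiT.
  exact: div_basis_enrich (div_basis1 phiT) (psiRT2_enrichment phiT).
have basis123 T : Th T -> div_basis T 3 (familyRT1_2_3 T (phi T)).
  move=> TT; apply: div_basis_enrich (basis12 T TT) _ => //.
  exact: familyRT3_enrichment (hphi T TT).
split.
- have compl T : Th T -> is_complement (RTint 1 T) (RTint_divfree 1 T) (RTint 1 T).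
    move=> /hphi phiT; rewrite {2}(RTint1_lspan phiT).
    exact: div_basis_complement (div_basis1 phiT).
  split.
    split=> //; exists (lspan (familyRT1 (ref_triangle R) (@ref_phi R))) => T TT.
    by rewrite (RTint1_lspan (hphi T TT)) (familyRT1_piola (hphi T TT)).
  move=> W [WC _] T TT psi; have phiT := hphi T TT.
  have psiE := familyRT1_enrichment phiT.
  have WE : lspan psi = W T.
    rewrite -(RTint1_lspan phiT).
    have [_ WR _ Wdec] := WC T TT; have [_ _ R0 _] := compl T TT.
    apply/seteqP; split => // v vR; have [w [d [wW dD ->]]] := Wdec v vR.
    suff -> : d = 0 by rewrite addr0.
    have : (RTint 1 T `&` RTint_divfree 1 T) d by split => //; case: dD.
    by rewrite R0.
  split=> //.
  + by move=> j; rewrite -WE; exact: lspan_mem.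
  + exact: enrichment_lin_indep psiE.
  + move=> j; rewrite -[RHS](enrichment_orthogonal psiE j (Pol_cst 0 1)).
    by congr tri_int; apply/funext => x; rewrite mulr1.
  + exact: enrichment_bij psiE.
- exists (fun T => lspan (familyRT1_2 T (phi T))); split.
    split=> [T TT|]; first exact: div_basis_complement (basis12 T TT).
    exists (lspan (familyRT1_2 (ref_triangle R) (@ref_phi R))) => T TT.
    exact: familyRT1_2_piola (hphi T TT).
  move=> T TT psi; have phiT := hphi T TT.
  have psiE := psiRT2_enrichment phiT.
  split.
  + move=> j; rewrite -[psi j](fam_catr (familyRT1 T (phi T)) psi j).
    exact: lspan_mem.
  + exact: enrichment_lin_indep psiE.
  + by move=> j k; apply: (enrichment_orthogonal psiE); exact: phi_Pol phiT k.
  + exact: enrichment_bij psiE.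
- exists (fun T => lspan (familyRT1_2_3 T (phi T))); split.
    split=> [T TT|]; first exact: div_basis_complement (basis123 T TT).
    exists (lspan (familyRT1_2_3 (ref_triangle R) (@ref_phi R))) => T TT.
    exact: familyRT1_2_3_piola (hphi T TT).
  move=> T TT psi; have phiT := hphi T TT.
  have psiE := familyRT3_enrichment phiT.
  split.
  + move=> j; rewrite -[psi j](fam_catr (familyRT1_2 T (phi T)) psi j).
    exact: lspan_mem.
  + exact: enrichment_lin_indep psiE.
  + by move=> j l lP; exact: (enrichment_orthogonal psiE).
  + exact: enrichment_bij psiE.
Qed.
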